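(* Let $G$ be a discrete group acting on a unital $C^*$-algebra $\mathcal{A}$ by $*$-automorphisms $\alpha_g \in \operatorname{Aut}(\mathcal{A})$, $g \in G$. Then the following are equivalent: (i) the inclusion $\mathcal{A} \subseteq \mathcal{A} \rtimes G$ of $\mathcal{A}$ into the full crossed product has the pure extension property; (ii) the inclusion $\mathcal{A} \subseteq \mathcal{A} \rtimes_r G$ of $\mathcal{A}$ into the reduced crossed product has the pure extension property; (iii) the induced action of $G$ on the spectrum $\widehat{\mathcal{A}}$ is free, i.e., for every $g \in G$ with $g \neq e$, $\{[\pi] \in \widehat{\mathcal{A}} : [\pi \circ \alpha_g] = [\pi]\} = \emptyset$.
   Context: A $C^*$-inclusion $\mathcal{A} \subseteq \mathcal{B}$ is an inclusion of unital $C^*$-algebras with $1_{\mathcal{A}} = 1_{\mathcal{B}}$. It has the pure extension property (PEP) if every pure state on $\mathcal{A}$ extends uniquely to a state on $\mathcal{B}$ (that is, has exactly one state extension, which is then automatically pure). The action is a group homomorphism $g \mapsto \alpha_g$ from $G$ to $\operatorname{Aut}(\mathcal{A})$, the group of $*$-automorphisms of $\mathcal{A}$; $e$ denotes the identity of $G$. $\mathcal{A} \rtimes G$ and $\mathcal{A} \rtimes_r G$ denote the full and reduced $C^*$-crossed products of this action; each contains $\mathcal{A}$ canonically, and contains unitaries (identified with the elements $g \in G$) satisfying $g a g^{-1} = \alpha_g(a)$ for $a \in \mathcal{A}$. The spectrum $\widehat{\mathcal{A}}$ is the set of unitary equivalence classes $[\pi]$ of non-zero irreducible representations $\pi : \mathcal{A}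 \to B(\mathcal{H})$ on Hilbert spaces, and $G$ acts on it by $g \cdot [\pi] = [\pi \circ \alpha_g]$. *)

(* Defs.v *)
From HB Require Import structures.
From mathcomp Require Import all_boot all_order all_algebra.
From mathcomp Require Import complex.
From mathcomp Require Import all_classical all_reals all_analysis.

Set Implicit Arguments.
Unset Strict Implicit.
Unset Printing Implicit Defensive.

Import Order.TTheory GRing.Theory Num.Theory.
Import numFieldNormedType.Exports.

Local Open Scope classical_set_scope.
Local Open Scope complex_scope.
Local Open Scope ring_scope.

(* The scalars are C := R[i] for R : realType.  The norm of a normedModType
   over R[i] takes values in R[i]; rnorm is the same norm read in R. *)
Definition rnorm (R : realType) (V : normedModType R[i]) (x : V) : R :=
  complex.Re `|x|.

(** * Unital C*-algebras *)

(* No library structure joins rings with normed modules, so the product is part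
   of the mixin, and the pzRingType structure is derived from it just below.
   The axiom 1 != 0 is not required: the zero algebra is allowed. *)
HB.mixin Record isCStar (R : realType) A of CompleteNormedModule R[i] A := {
  cstar_mul : A -> A -> A ;
  cstar_one : A ;
  star : A -> A ;
  cstar_mulA : associative cstar_mul ;
  cstar_mul1 : left_id cstar_one cstar_mul ;
  cstar_mulr1 : right_id cstar_one cstar_mul ;
  cstar_mulDl : left_distributive cstar_mul +%R ;
  cstar_mulDr : right_distributive cstar_mul +%R ;
  cstar_scaleAl : forall (c : R[i]) (x y : A),
    c *: cstar_mul x y = cstar_mul (c *: x) y ;
  cstar_scaleAr : forall (c : R[i]) (x y : A),
    c *: cstar_mul x y = cstar_mul x (c *: y) ;
  starK : involutive star ;
  starD : {morph star : x y / x + y} ;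
  starZ : forall (c : R[i]) (x : A), star (c *: x) = c^* *: star x ;
  starM : forall x y : A, star (cstar_mul x y) = cstar_mul (star y) (star x) ;
  cstar_normM : forall x y : A, `|cstar_mul x y| <= `|x| * `|y| ;
  cstar_norm : forall x : A, `|cstar_mul (star x) x| = `|x| ^+ 2
}.

#[short(type="cstarType")]
HB.structure Definition CStarAlgebra (R : realType) :=
  {A of isCStar R A & CompleteNormedModule R[i] A}.

HB.instance Definition _ (R : realType) (A : cstarType R) :=
  GRing.Zmodule_isPzRing.Build (CStarAlgebra.sort A)
    (@cstar_mulA R A) (@cstar_mul1 R A) (@cstar_mulr1 R A)
    (@cstar_mulDl R A) (@cstar_mulDr R A).

Record star_morphism (R : realType) (A B : cstarType R) (f : A -> B) : Prop := {
  star_morphism_linear : linear f ;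
  star_morphism1 : f 1 = 1 ;
  star_morphismM : forall x y, f (x * y) = f x * f y ;
  star_morphism_star : forall x, f (star x) = star (f x)
}.

Definition star_automorphism (R : realType) (A : cstarType R) (f : A -> A) :=
  star_morphism f /\ bijective f.

Record action_by_automorphisms (R : realType) (G : groupType) (A : cstarType R)
    (alpha : G -> A -> A) : Prop := {
  action_auto : forall g, star_automorphism (alpha g) ;
  actionM : forall g h, alpha (g * h)%g = alpha g \o alpha h
}.

(** * States and the pure extension property *)

Record state (R : realType) (A : cstarType R) (phi : A -> R[i]) : Prop := {
  state_linear : scalar phi ;
  state_ge0 : forall x, 0 <= phi (star x * x) ;
  state1 : phi 1 = 1
}.

(* Pure states are the extreme points of the state space. *)
Definition pure_state (R : realType) (A : cstarType R) (phi : A -> R[i]) :=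
  state phi /\
  forall (psi1 psi2 : A -> R[i]) (t : R),
    state psi1 -> state psi2 -> 0 < t < 1 ->
    (forall x, phi x = t%:C * psi1 x + (1 - t)%:C * psi2 x) ->
    psi1 = phi /\ psi2 = phi.

(* The inclusion is given by the embedding iota. *)
Definition pure_extension_property (R : realType) (A B : cstarType R)
    (iota : A -> B) :=
  forall phi : A -> R[i], pure_state phi ->
    exists! psi : B -> R[i], state psi /\ psi \o iota = phi.

(** * Hilbert spaces and representations *)

(* Inner products are linear in the first variable. *)
HB.mixin Record isHilbert (R : realType) H of CompleteNormedModule R[i] H := {
  inner : {dot H for Num.conj} ;
  inner_norm : forall x : H, inner x x = `|x| ^+ 2
}.

#[short(type="hilbertType")]
HB.structure Definition Hilbert (R : realType) :=
  {H of isHilbert R H & CompleteNormedModule R[i] H}.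

(* pi : A -> B(H); it need not be unital. *)
Record representation (R : realType) (A : cstarType R) (H : hilbertType R)
    (pi : A -> H -> H) : Prop := {
  rep_op_linear : forall a, linear (pi a) ;
  rep_op_continuous : forall a, continuous (pi a) ;
  rep_linear : forall x, linear (pi^~ x) ;
  repM : forall a b x, pi (a * b) x = pi a (pi b x) ;
  rep_star : forall a x y, inner (pi (star a) x) y = inner x (pi a y)
}.

Record closed_subspace (R : realType) (H : hilbertType R) (S : set H) : Prop := {
  closed_subspace0 : S 0 ;
  closed_subspaceP : forall (c : R[i]) x y, S x -> S y -> S (c *: x + y) ;
  closed_subspace_closed : closed S
}.

Definition nonzero_irreducible (R : realType) (A : cstarType R)
    (H : hilbertType R) (pi : A -> H -> H) :=
  (exists a x, pi a x != 0) /\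
  forall S : set H, closed_subspace S -> (forall a x, S x -> S (pi a x)) ->
    S = [set 0] \/ S = setT.

Record irrep (R : realType) (A : cstarType R) := Irrep {
  irrep_space : hilbertType R ;
  irrep_fun :> A -> irrep_space -> irrep_space ;
  irrep_rep : representation irrep_fun ;
  irrep_irr : nonzero_irreducible irrep_fun
}.

Definition unitarily_equivalent (R : realType) (A : cstarType R)
    (pi rho : irrep A) :=
  exists U : irrep_space pi -> irrep_space rho,
    [/\ linear U, (forall x y, inner (U x) (U y) = inner x y),
        (forall y, exists x, U x = y) &
        forall a x, U (pi a x) = rho a (U x)].

(* [pi].  Classes are predicates rather than terms of type set (irrep A),
   because irrep A is too large for the universe of set. *)
Definition irrep_class (R : realType) (A : cstarType R) (pi : irrep A) :
    irrep A -> Prop :=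
  fun rho => unitarily_equivalent pi rho.

Definition spectrum (R : realType) (A : cstarType R) (x : irrep A -> Prop) :=
  exists pi : irrep A, x = irrep_class pi.

(* pi \o f is again an irreducible representation *)
Lemma representation_twist (R : realType) (A : cstarType R) (f : A -> A)
    (hf : star_automorphism f) (H : hilbertType R) (pi : A -> H -> H) :
  representation pi -> representation (pi \o f).
Proof.
case: hf => -[fl f1 fM fs] _ [h1 h2 h3 h4 h5]; split => /=.
- by move=> a; exact: h1.
- by move=> a; exact: h2.
- by move=> x c a b /=; rewrite fl h3.
- by move=> a b x; rewrite fM h4.
- by move=> a x y; rewrite fs h5.
Qed.

Lemma irreducible_twist (R : realType) (A : cstarType R) (f : A -> A)
    (hf : star_automorphism f) (H : hilbertType R) (pi : A -> H -> H) :
  nonzero_irreducible pi -> nonzero_irreducible (pi \o f).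
Proof.
case: hf => _ [g fK gK] [[a [x ax]] irr]; split.
  by exists (g a), x; rewrite /= gK.
move=> S cS SA; apply: irr => // b y Sy.
by have := SA (g b) y Sy; rewrite /= gK.
Qed.

Definition irrep_twist (R : realType) (A : cstarType R) (f : A -> A)
    (hf : star_automorphism f) (pi : irrep A) : irrep A :=
  Irrep (representation_twist hf (irrep_rep pi))
        (irreducible_twist hf (irrep_irr pi)).

(* g . x; see spectrum_act_class *)
Definition spectrum_act (R : realType) (G : groupType) (A : cstarType R)
    (alpha : G -> A -> A) (act : action_by_automorphisms alpha) (g : G)
    (x : irrep A -> Prop) : irrep A -> Prop :=
  fun rho => exists2 pi, x pi &
    unitarily_equivalent (irrep_twist (action_auto act g) pi) rho.

Lemma spectrum_act_class (R : realType) (G : groupType) (A : cstarType R)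
    (alpha : G -> A -> A) (act : action_by_automorphisms alpha) (g : G)
    (pi : irrep A) :
  spectrum_act act g (irrep_class pi) =
  irrep_class (irrep_twist (action_auto act g) pi).
Proof.
apply/funext => rho; apply/propext; split; last first.
  by exists pi => //; exists id; split=> // y; exists y.
case=> pi' [U [Ul Ui Us UE]] [V [Vl Vi Vs VE]]; exists (V \o U); split => /=.
- by move=> c x y; exact: etrans (congr1 V (Ul c x y)) (Vl _ _ _).
- by move=> x y; rewrite Vi.
- by move=> y; have [z <-] := Vs y; have [x <-] := Us z; exists x.
- by move=> a x; rewrite UE VE.
Qed.

Definition free_on_spectrum (R : realType) (G : groupType) (A : cstarType R)
    (alpha : G -> A -> A) (act : action_by_automorphisms alpha) :=
  forall g : G, g <> 1%g ->
    ~ exists x : irrep A -> Prop, spectrum x /\ spectrum_act act g x = x.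

(** * Crossed products *)

(* Elements of C_c(G, A): finitely supported functions. *)
Definition fin_supp (G : choiceType) (A : zmodType) (f : G -> A) :=
  finite_set [set g | f g != 0].

(* sum_g pi(f(g)) U_g *)
Definition integrated (G : choiceType) (A V : zmodType) (pi : A -> V -> V)
    (U : G -> V -> V) (f : G -> A) (x : V) : V :=
  \sum_(g \in setT) pi (f g) (U g x).

Record unitary_rep (R : realType) (G : groupType) (H : hilbertType R)
    (U : G -> H -> H) : Prop := {
  unitary_rep_linear : forall g, linear (U g) ;
  unitary_rep_inner : forall g x y, inner (U g x) (U g y) = inner x y ;
  unitary_rep1 : forall x, U 1%g x = x ;
  unitary_repM : forall g h x, U (g * h)%g x = U g (U h x)
}.

Record covariant_rep (R : realType) (G : groupType) (A : cstarType R)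
    (alpha : G -> A -> A) (H : hilbertType R)
    (pi : A -> H -> H) (U : G -> H -> H) : Prop := {
  covariant_rep_pi : representation pi ;
  covariant_rep_unital : forall x, pi 1 x = x ;
  covariant_rep_U : unitary_rep U ;
  covariant_repP : forall g a x, U g (pi a (U g^-1%g x)) = pi (alpha g a) x
}.

Definition opnorm (R : realType) (V : Type) (nrm : V -> \bar R) (T : V -> V) :
    \bar R :=
  ereal_sup [set nrm (T x) | x in [set x | (nrm x <= 1)%E]].

Definition full_norm (R : realType) (G : groupType) (A : cstarType R)
    (alpha : G -> A -> A) (f : G -> A) : \bar R :=
  ereal_sup [set N | exists (H : hilbertType R) (pi : A -> H -> H)
      (U : G -> H -> H), covariant_rep alpha pi U /\
      N = opnorm (fun x : H => (rnorm x)%:E) (integrated pi U f)].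

(* The norm of l^2(G, H); it is +oo outside of l^2(G, H). *)
Definition l2norm (R : realType) (G : groupType) (H : hilbertType R)
    (xi : G -> H) : \bar R :=
  sqrte (\esum_(t in setT) ((rnorm (xi t)) ^+ 2)%:E).

(* The regular covariant representation on l^2(G, H) induced by pi. *)
Definition regular_pi (R : realType) (G : groupType) (A : cstarType R)
    (alpha : G -> A -> A) (H : hilbertType R) (pi : A -> H -> H)
    (a : A) (xi : G -> H) : G -> H :=
  fun t => pi (alpha t^-1%g a) (xi t).

Definition regular_U (R : realType) (G : groupType) (H : hilbertType R)
    (s : G) (xi : G -> H) : G -> H :=
  fun t => xi (s^-1 * t)%g.

Definition reduced_norm (R : realType) (G : groupType) (A : cstarType R)
    (alpha : G -> A -> A) (f : G -> A) : \bar R :=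
  ereal_sup [set N | exists (H : hilbertType R) (pi : A -> H -> H),
      representation pi /\
      N = opnorm (@l2norm R G H)
            (integrated (regular_pi alpha pi) (@regular_U R G H) f)].

(* (B, iota, u) is the completion of the *-algebra C_c(G, A) of formal finite
   sums sum_g f(g) g, subject to g a g^-1 = alpha_g(a) and g^* = g^-1, in the
   norm nrm.  This determines B up to an isomorphism compatible with iota and
   u. *)
Record crossed_product_for (R : realType) (G : groupType) (A : cstarType R)
    (alpha : G -> A -> A) (nrm : (G -> A) -> \bar R)
    (B : cstarType R) (iota : A -> B) (u : G -> B) : Prop := {
  crossed_iota : star_morphism iota ;
  crossed_u_unitary : forall g, star (u g) * u g = 1 /\ u g * star (u g) = 1 ;
  crossed_uM : forall g h, u (g * h)%g = u g * u h ;
  crossed_covariant : forall g a, u g * iota a * star (u g) = iota (alpha g a) ;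
  crossed_norm : forall f, fin_supp f ->
    (rnorm (\sum_(g \in setT) iota (f g) * u g))%:E = nrm f ;
  crossed_dense :
    closure [set \sum_(g \in setT) iota (f g) * u g | f in @fin_supp G A] = setT
}.

Definition full_crossed_product (R : realType) (G : groupType)
    (A : cstarType R) (alpha : G -> A -> A) :=
  crossed_product_for alpha (full_norm alpha).

Definition reduced_crossed_product (R : realType) (G : groupType)
    (A : cstarType R) (alpha : G -> A -> A) :=
  crossed_product_for alpha (reduced_norm alpha).

(* Main.v *)
(* A covariant pair turns the question into one about vectors.  Let phi be a pure
   state of A with GNS space H, and let psi be a state of A x| G extending it.
   The form (a, b) |-> psi(b^* g a) is bounded on H, so it defines an operator T
   with T pi(c) = pi(alpha_g(c)) T.  Purity of phi forces T^* T to be a scalar, so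
   unless T = 0 a multiple of T is a unitary equivalence between [pi] and
   g . [pi].  Hence freeness gives psi(a g) = 0 for g <> e, which determines psi.
   Conversely, if V is a unitary with V pi(a) = pi(alpha_g^-1(a)) V and xi is a unit
   vector, then for |c| = 1 the vectors (delta_e (x) xi + delta_g (x) c V xi) / sqrt 2
   of the regular representation all restrict to the vector state of xi on A, but
   they cannot all give the same functional a |-> psi(a g); that vector state is
   pure by Schur's lemma.  Finally, a state of the reduced crossed product lifts to the
   full one because its GNS representation is covariant; this transports
   existence and uniqueness of extensions between the two. *)
Require Import Defs.
From HB Require Import structures.
From mathcomp Require Import all_boot all_order all_algebra.
From mathcomp Require Import complex.
From mathcomp Require Import all_classical all_reals all_analysis.
From mathcomp Require Import ring lra.

Set Implicit Arguments.
Unset Strict Implicit.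
Unset Printing Implicit Defensive.

Import Order.TTheory GRing.Theory Num.Theory.
Import numFieldNormedType.Exports.

Local Open Scope classical_set_scope.
Local Open Scope complex_scope.
Local Open Scope ring_scope.

(** * Real-valued norms and convergence *)

(** No functional calculus or spectral theory enters. A single iteration for the square root of 1 -
    k, with k a contraction of a Banach space, is used twice. With k the left multiplication by a
    selfadjoint h it writes 1 - h as x^* x, which makes the GNS operators bounded; with k = 1 - h^2
    on a Hilbert space it produces |h|, from which Schur's lemma follows. The GNS space is taken to
    be the bounded antilinear functionals on A with the form phi(b^* a). Null vectors and Cauchy
    classes then never have to be divided out, and a bounded form is at once an operator. On the
    crossed products, states are handled only through their coefficients psi(a g) on finite formal
    sums. By density they determine psi, and a family of coefficients comes from a state once it is
    bounded by the norm, nonnegative on all f^* f and normalised. The full and the reduced product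
    are therefore compared without a homomorphism between them. *)

Section Modulus.
Context (R : realType).
Implicit Types (c d : R[i]) (r : R).

Definition modulus c : R := complex.Re `|c|.

Lemma modulusE c : `|c| = (modulus c)%:C.
Proof. by rewrite /modulus normc_def. Qed.

Lemma modulus_ge0 c : 0 <= modulus c.
Proof. by rewrite -ler0c -modulusE normr_ge0. Qed.

Lemma modulus0 : modulus 0 = 0 :> R.
Proof. by rewrite /modulus normr0. Qed.

Lemma modulusD c d : modulus (c + d) <= modulus c + modulus d.
Proof. by rewrite -lecR rmorphD -!modulusE ler_normD. Qed.

Lemma modulusM c d : modulus (c * d) = modulus c * modulus d.
Proof. by apply: complexI; rewrite rmorphM -!modulusE normrM. Qed.

Lemma modulusN c : modulus (- c) = modulus c.
Proof. by rewrite /modulus normrN. Qed.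

Lemma modulusBC c d : modulus (c - d) = modulus (d - c).
Proof. by rewrite -modulusN opprB. Qed.

Lemma modulus_conj c : modulus (c^*)%R = modulus c.
Proof. by rewrite /modulus norm_conjC. Qed.

Lemma modulus_real r : modulus r%:C = `|r|.
Proof. by rewrite /modulus normc_def /= expr0n addr0 sqrtr_sqr. Qed.

Lemma modulus_eq0 c : modulus c = 0 -> c = 0.
Proof. by move=> c0; apply/eqP; rewrite -normr_eq0 modulusE c0. Qed.

Lemma sqr_modulus c : modulus c ^+ 2 = complex.Re c ^+ 2 + complex.Im c ^+ 2.
Proof.
by rewrite /modulus normc_def /= sqr_sqrtr// addr_ge0 ?sqr_ge0.
Qed.

Lemma conjM_modulus c : (c * c^*)%R = ((modulus c) ^+ 2)%:C.
Proof. by rewrite -normCK modulusE rmorphXn. Qed.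

Lemma Re_le_modulus c : `|complex.Re c| <= modulus c.
Proof.
rewrite -(ler_pXn2r (ltn0Sn 1)) ?nnegrE ?modulus_ge0 //.
by rewrite real_normK ?num_real// sqr_modulus lerDl sqr_ge0.
Qed.

Lemma Im_le_modulus c : `|complex.Im c| <= modulus c.
Proof.
rewrite -(ler_pXn2r (ltn0Sn 1)) ?nnegrE ?modulus_ge0 //.
by rewrite real_normK ?num_real// sqr_modulus lerDr sqr_ge0.
Qed.

Lemma modulus_le c : modulus c <= `|complex.Re c| + `|complex.Im c|.
Proof.
rewrite -(ler_pXn2r (ltn0Sn 1)) ?nnegrE ?modulus_ge0 ?addr_ge0 //.
rewrite sqr_modulus sqrrD !real_normK ?num_real//.
by rewrite lerD2r lerDl mulrn_wge0// mulr_ge0.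
Qed.

End Modulus.

Section Rnorm.
Context (R : realType) (V : normedModType R[i]).
Implicit Types x y z : V.

Lemma rnormE x : `|x| = (rnorm x)%:C.
Proof.
rewrite /rnorm; have /complex_realP[r ->] // : `|x| \is Num.real.
by rewrite ger0_real.
Qed.

Lemma rnorm_ge0 x : 0 <= rnorm x.
Proof. by rewrite -ler0c -rnormE; exact: normr_ge0. Qed.

Lemma rnorm0 : rnorm (0 : V) = 0.
Proof. by rewrite /rnorm normr0. Qed.

Lemma rnorm_eq0 x : rnorm x = 0 -> x = 0.
Proof. by move=> x0; apply/eqP; rewrite -normr_eq0 rnormE x0. Qed.

Lemma rnormD x y : rnorm (x + y) <= rnorm x + rnorm y.
Proof. by rewrite -lecR rmorphD /= -!rnormE; exact: ler_normD. Qed.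

Lemma rnormN x : rnorm (- x) = rnorm x.
Proof. by rewrite /rnorm normrN. Qed.

Lemma rnormBC x y : rnorm (x - y) = rnorm (y - x).
Proof. by rewrite -rnormN opprB. Qed.

Lemma rnormZ c x : rnorm (c *: x) = modulus c * rnorm x.
Proof. by apply: complexI; rewrite rmorphM /= -modulusE -!rnormE; exact: normrZ. Qed.

Lemma rnorm_triangle x y z : rnorm (x - z) <= rnorm (x - y) + rnorm (y - z).
Proof. by rewrite (le_trans _ (rnormD _ _))// addrA subrK. Qed.

Lemma rnorm_sub_le x y : rnorm x <= rnorm y + rnorm (x - y).
Proof. by rewrite (le_trans _ (rnormD _ _))// addrC subrK. Qed.

Lemma closureP (S : set V) x :
  closure S x <-> forall e : R, 0 < e -> exists2 y, S y & rnorm (x - y) < e.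
Proof.
split=> [Sx e e0|Sx B].
  have := Sx (ball x e%:C); case; first by apply: nbhsx_ballx; rewrite ltcR.
  by move=> y [Sy]; rewrite -ball_normE /= rnormE ltcR; exists y.
rewrite -nbhs_ballE => -[e /= e0 eB].
have /complex_realP[r er] : e \is Num.real by rewrite gtr0_real.
move: e0 eB; rewrite er ltcR => r0 eB.
have [y Sy xy] := Sx r r0; exists y; split=> //; apply: eB.
by rewrite -ball_normE /= rnormE ltcR.
Qed.

End Rnorm.

Section Sequences.
Context (R : realType).

(** Limits are replaced throughout by explicit errors: a relation is proved up to K / (n + 1) for
    every n and then closed by this Archimedean argument. *)
Lemma le0_inv_nat (K r : R) : (forall n, r <= K * n.+1%:R^-1) -> r <= 0.
Proof.
move=> rK; rewrite leNgt; apply/negP => r0.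
have K0 : 0 < K by have := rK 0%N; rewrite invr1 mulr1; exact: lt_le_trans.
have := rK (Num.trunc (K / r)); rewrite leNgt => /negP; apply.
rewrite ltr_pdivrMr// mulrC -ltr_pdivrMr //.
by have := truncnS_gt (K / r).
Qed.

Lemma inv_nat_lt (e : R) : 0 < e -> exists n, n.+1%:R^-1 < e.
Proof.
move=> e0; apply/not_existsP => H.
have := @le0_inv_nat 1 e; rewrite leNgt e0 => /(_ _)/negP; apply=> // n.
by rewrite mul1r leNgt; apply/negP/H.
Qed.

(** The Cauchy condition carries a rate so that the limit inherits it, and later arguments can work
    with [le0_inv_nat] instead of filters. *)
Lemma complete_seq (V : CompleteNormedModule.type R[i]) (K : R) (u : nat -> V) :
  (forall n m, rnorm (u n - u m) <= K * n.+1%:R^-1 + K * m.+1%:R^-1) ->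
  exists l, forall n, rnorm (u n - l) <= K * n.+1%:R^-1.
Proof.
move=> uC.
have K0 : 0 <= K.
  have := uC 0%N 0%N; rewrite subrr rnorm0 invr1 mulr1 -mulr2n.
  by rewrite pmulrn_lge0.
have : cauchy (u @ \oo).
  apply/cauchy_exP => e e0.
  have /complex_realP[r er] : e \is Num.real by rewrite gtr0_real.
  move: e0; rewrite er ltcR => r0.
  have [N HN] : exists N, (K + K) * N.+1%:R^-1 < r.
    case: (ltrP 0 (K + K)) => [K2|K2]; last first.
      by exists 0%N; rewrite invr1 mulr1 (le_lt_trans K2).
    have [N NN] := inv_nat_lt (divr_gt0 r0 K2); exists N.
    by rewrite mulrC -ltr_pdivlMr.
  exists (u N); exists N => // m /= Nm.
  rewrite -ball_normE /= rnormE ltcR (le_lt_trans (uC _ _))//.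
  rewrite (le_lt_trans _ HN)// mulrDl lerD2l ler_wpM2l//.
  by rewrite lef_pV2 ?posrE ?ler_nat ?ltr0Sn// ltnS.
move/cauchy_cvg/cvg_ex => -[l ul]; exists l => n.
rewrite -subr_le0; apply: (@le0_inv_nat (K + 1)) => m.
have : \forall k \near \oo, rnorm (l - u k) < m.+1%:R^-1.
  have e0 : (0 : R[i]) < (m.+1%:R^-1)%:C by rewrite ltcR invr_gt0 ltr0Sn.
  have /cvgrPdist_lt/(_ _ e0) := ul; apply: filterS => k.
  by rewrite rnormE ltcR.
case=> N _ NP; pose k := maxn N m.
have kl := NP k (leq_maxl _ _).
have := rnorm_triangle (u n) (u k) l; have := uC n k; rewrite [rnorm (u k - l)]rnormBC.
have : K * k.+1%:R^-1 <= K * m.+1%:R^-1.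
  by rewrite ler_wpM2l// lef_pV2 ?posrE ?ler_nat ?ltr0Sn// ltnS leq_maxr.
rewrite mulrDl mul1r; move: kl.
move: (K / k.+1%:R) (K / n.+1%:R) (K / m.+1%:R) (m.+1%:R^-1) => p q r s.
by move=> *; lra.
Qed.

(** The intervals of radius K / (n + 1) around u n meet pairwise, so the supremum of their left
    endpoints lies in all of them. *)
Lemma real_complete_seq (K : R) (u : nat -> R) :
  (forall n m, `|u n - u m| <= K * n.+1%:R^-1 + K * m.+1%:R^-1) ->
  exists l, forall n, `|u n - l| <= K * n.+1%:R^-1.
Proof.
move=> uC.
pose D := [set u n - K * n.+1%:R^-1 | n in setT].
have ubD m : ubound D (u m + K * m.+1%:R^-1).
  move=> _ [n _ <-]; have := uC n m; rewrite ler_distl => /andP[_].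
  by move: (K / _) (K / _) => p q *; lra.
have supD : has_sup D.
  by split; [exists (u 0%N - K * 1%:R^-1); exists 0%N|exists (u 0%N + K * 1%:R^-1);
    exact: (ubD 0%N)].
exists (sup D) => n; rewrite distrC ler_distl; apply/andP; split.
  by apply: sup_upper_bound => //; exists n.
by apply: ge_sup; [case: supD|exact: ubD].
Qed.

Lemma complex_complete_seq (K : R) (u : nat -> R[i]) :
  (forall n m, modulus (u n - u m) <= K * n.+1%:R^-1 + K * m.+1%:R^-1) ->
  exists l, forall n, modulus (u n - l) <= (K + K) * n.+1%:R^-1.
Proof.
move=> uC.
have [|a Ha] := @real_complete_seq K (fun n => complex.Re (u n)).
  by move=> n m; rewrite -raddfB (le_trans (Re_le_modulus _)).
have [|b Hb] := @real_complete_seq K (fun n => complex.Im (u n)).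
  by move=> n m; rewrite -raddfB (le_trans (Im_le_modulus _)).
exists (a +i* b) => n; rewrite (le_trans (modulus_le _))// mulrDl lerD//.
  by have := Ha n; case: (u n).
by have := Hb n; case: (u n).
Qed.

End Sequences.

(** * Square roots of 1 - k by iteration *)

Section SqrtIteration.
Context (R : realType).

(** The iteration [sqrt_iter] below in the scalar case k = 1. It increases to 1 and dominates the
    operator iterates and their increments. *)
Fixpoint sqrt_rate n : R :=
  if n is n'.+1 then 2^-1 * (1 + sqrt_rate n' ^+ 2) else 0.

Lemma sqrt_rate_itv n : 0 <= sqrt_rate n <= 1.
Proof.
elim: n => [|n IH] /=; first by rewrite lexx ler01.
by move: (sqrt_rate n) IH => t /andP[t0 t1]; apply/andP; split; nra.
Qed.

Lemma sqrt_rate_lt n : 1 - sqrt_rate n <= 2 * n.+1%:R^-1.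
Proof.
(* The induction closes with n + 2: the defect d = 1 - t becomes d (2 - d) / 2, which increases with
   d on [0, 1], and d <= 2 / (n + 2) turns into 2 (n + 1) / (n + 2)^2 <= 2 / (n + 3). *)
suff : (1 - sqrt_rate n) * n.+2%:R <= 2.
  rewrite -ler_pdivlMr ?ltr0Sn// => /le_trans; apply.
  by rewrite ler_pM2l// lef_pV2 ?posrE ?ler_nat ?ltr0Sn.
elim: n => [|n IH] /=; first by rewrite subr0 mul1r.
have := sqrt_rate_itv n; move: IH; rewrite -![_.+3%:R]natr1 -![_.+2%:R]natr1 -natr1.
have : 0 <= n%:R :> R by [].
move: (sqrt_rate n) (n%:R) => t a a0 IH /andP[t0 t1].
suff : (1 - t) * (2 - (1 - t)) * (a + 3) <= 4.
  have -> : 1 - (1 + 1)^-1 * (1 + t ^+ 2) = 2^-1 * ((1 - t) * (2 - (1 - t))) by field.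
  by move: (_ * (2 - _)) => z; nra.
have [d0 d1] : 0 <= 1 - t /\ 1 - t <= 1 by split; lra.
move: (1 - t) d0 d1 IH => d d0 d1 IH.
have a2 : 0 < a + 2 by lra.
have dle : d <= 2 / (a + 2) by rewrite ler_pdivlMr//; lra.
have : d * (2 - d) <= 4 * (a + 1) / (a + 2) ^+ 2.
  have -> : 4 * (a + 1) / (a + 2) ^+ 2 = (2 / (a + 2)) * (2 - 2 / (a + 2)) by field; lra.
  have : 2 / (a + 2) <= 1 by rewrite ler_pdivrMr//; lra.
  by move: (2 / (a + 2)) dle => e de e1; nra.
rewrite ler_pdivlMr ?exprn_gt0// => H.
by move: (d * (2 - d)) H => z; nra.
Qed.

Lemma sqrt_rate_mono n : sqrt_rate n <= sqrt_rate n.+1.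
Proof.
rewrite /=; have /andP[] := sqrt_rate_itv n.
by move: (sqrt_rate n) => t *; nra.
Qed.

Context (V : CompleteNormedModule.type R[i]) (k : V -> V).

(* The iteration for the solution y of 2 y = k + y^2, that is, of
   (1 - y)^2 = 1 - k. *)
Fixpoint sqrt_iter n (x : V) : V :=
  if n is n'.+1 then (2^-1)%:C *: (k x + sqrt_iter n' (sqrt_iter n' x)) else 0.

Hypotheses (klin : linear k) (kle : forall x, rnorm (k x) <= rnorm x).

Lemma sqrt_iter_linear n : linear (sqrt_iter n).
Proof.
elim: n => [|n IH] c x y /=; first by rewrite scaler0 addr0.
rewrite klin !IH addrACA -scalerDr [LHS]scalerDr; congr (_ + _).
by rewrite !scalerA mulrC.
Qed.

Lemma sqrt_iterB n x y : sqrt_iter n (x - y) = sqrt_iter n x - sqrt_iter n y.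
Proof. by rewrite addrC -scaleN1r sqrt_iter_linear scaleN1r addrC. Qed.

Lemma rnorm_sqrt_iter n x : rnorm (sqrt_iter n x) <= sqrt_rate n * rnorm x.
Proof.
elim: n x => [|n IH] x /=; first by rewrite rnorm0 mul0r.
rewrite rnormZ modulus_real ger0_norm ?invr_ge0// -mulrA ler_pM2l ?invr_gt0//.
rewrite (le_trans (rnormD _ _))// mulrDl mul1r lerD// (le_trans (IH _))//.
by rewrite expr2 -mulrA ler_wpM2l//; case/andP: (sqrt_rate_itv n).
Qed.

(** Writing y_n for the iterates, y_(n+1)^2 - y_n^2 = y_(n+1) (y_(n+1) - y_n) + (y_(n+1) - y_n) y_n
    holds without commuting anything. The scalar sequence obeys the same identity with nonnegative
    terms, so it dominates by induction. *)
Lemma sqrt_iter_step n x : rnorm (sqrt_iter n.+1 x - sqrt_iter n x) <=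
  (sqrt_rate n.+1 - sqrt_rate n) * rnorm x.
Proof.
elim: n x => [|n IH] x.
  have := rnorm_sqrt_iter 1 x; rewrite /= !subr0; exact.
have -> : sqrt_iter n.+2 x - sqrt_iter n.+1 x = (2^-1)%:C *:
  (sqrt_iter n.+1 (sqrt_iter n.+1 x - sqrt_iter n x) +
   (sqrt_iter n.+1 (sqrt_iter n x) - sqrt_iter n (sqrt_iter n x))).
  rewrite sqrt_iterB addrA subrK.
  rewrite [LHS]/= -/(sqrt_iter n.+1) -scalerBr; congr (_ *: _).
  by rewrite opprD addrACA subrr add0r.
rewrite rnormZ modulus_real ger0_norm ?invr_ge0//.
have -> : sqrt_rate n.+2 - sqrt_rate n.+1 = 2^-1 *
  (sqrt_rate n.+1 * (sqrt_rate n.+1 - sqrt_rate n) +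
  (sqrt_rate n.+1 - sqrt_rate n) * sqrt_rate n) by rewrite /=; field.
have /andP[t0 _] := sqrt_rate_itv n.+1; have tm := sqrt_rate_mono n.
rewrite -mulrA ler_pM2l ?invr_gt0// (le_trans (rnormD _ _))// mulrDl lerD//.
  rewrite (le_trans (rnorm_sqrt_iter _ _))// -mulrA ler_wpM2l//.
rewrite (le_trans (IH _))// -mulrA ler_wpM2l ?subr_ge0// rnorm_sqrt_iter//.
Qed.

Lemma sqrt_iter_dist n p x : rnorm (sqrt_iter (n + p) x - sqrt_iter n x) <=
  (sqrt_rate (n + p) - sqrt_rate n) * rnorm x.
Proof.
elim: p => [|p IH]; first by rewrite addn0 !subrr rnorm0 mul0r.
rewrite addnS (le_trans (rnorm_triangle _ (sqrt_iter (n + p) x) _))//.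
have := sqrt_iter_step (n + p) x; move: IH.
move: (sqrt_rate _) (sqrt_rate (n + p)) (sqrt_rate (n + p).+1) (rnorm x).
by move=> a b c d *; lra.
Qed.

Lemma sqrt_iter_cauchy n m x : rnorm (sqrt_iter n x - sqrt_iter m x) <=
  (2 * rnorm x) * n.+1%:R^-1 + (2 * rnorm x) * m.+1%:R^-1.
Proof.
wlog nm : n m / (n <= m)%N => [H|].
  case/orP: (leq_total n m) => /H //.
  by rewrite rnormBC [leRHS]addrC.
rewrite rnormBC -(subnKC nm) (le_trans (sqrt_iter_dist _ _ _))// subnKC//.
have /andP[_ t1] := sqrt_rate_itv m.
have := sqrt_rate_lt n; have := rnorm_ge0 x.
have : (0 : R) <= m.+1%:R^-1 by rewrite invr_ge0.
move: t1; move: (n.+1%:R^-1) (m.+1%:R^-1) => a b.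
move: (rnorm x) (sqrt_rate n) (sqrt_rate m).
by move=> *; nra.
Qed.

Lemma sqrt_iter_lim : exists Y : V -> V,
  [/\ forall x n, rnorm (sqrt_iter n x - Y x) <= (2 * rnorm x) * n.+1%:R^-1,
      linear Y, forall x, rnorm (Y x) <= rnorm x &
      forall x, Y x + Y x = k x + Y (Y x)].
Proof.
have /choice[Y YP] : forall x, exists l, forall n,
    rnorm (sqrt_iter n x - l) <= (2 * rnorm x) * n.+1%:R^-1.
  by move=> x; apply: complete_seq => n m; exact: sqrt_iter_cauchy.
have Yle x : rnorm (Y x) <= rnorm x.
  rewrite -subr_le0; apply: (@le0_inv_nat _ (2 * rnorm x)) => n.
  have := rnorm_sqrt_iter n x; have /andP[_ t1] := sqrt_rate_itv n.
  have := rnorm_sub_le (Y x) (sqrt_iter n x); have := YP x n.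
  rewrite rnormBC; have := rnorm_ge0 x; move: (_ / _) => a.
  by move=> *; nra.
have Ylin : linear Y.
  move=> c x y; apply/subr0_eq/rnorm_eq0/eqP; rewrite eq_le rnorm_ge0 andbT.
  pose M := 2 * rnorm (c *: x + y) + modulus c * (2 * rnorm x) + 2 * rnorm y.
  apply: (@le0_inv_nat _ M) => n.
  have -> : Y (c *: x + y) - (c *: Y x + Y y) =
    - (sqrt_iter n (c *: x + y) - Y (c *: x + y)) +
    (c *: (sqrt_iter n x - Y x) + (sqrt_iter n y - Y y)).
    by rewrite sqrt_iter_linear scalerBr addrACA -opprD opprB addrC addrA subrK addrC.
  rewrite (le_trans (rnormD _ _))// rnormN /M -addrA mulrDl lerD//.
  rewrite (le_trans (rnormD _ _))// mulrDl lerD// rnormZ -mulrA.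
  by rewrite ler_wpM2l ?modulus_ge0.
exists Y; split=> // x.
apply/subr0_eq/rnorm_eq0/eqP; rewrite eq_le rnorm_ge0 andbT.
pose M := 2 * (2 * rnorm x) + (2 * rnorm x + 2 * rnorm (Y x)).
apply: (@le0_inv_nat _ (M + M)) => n.
(* Insert the recursion 2 y_(n+1) = k + y_n^2. What remains are the errors of the limit at x and at
   Y x, one of them pushed through the contraction y_n. *)
have -> : Y x + Y x - (k x + Y (Y x)) =
    - ((sqrt_iter n.+1 x - Y x) + (sqrt_iter n.+1 x - Y x)) +
    (sqrt_iter n (sqrt_iter n x - Y x) + (sqrt_iter n (Y x) - Y (Y x))).
  rewrite sqrt_iterB.
  have : sqrt_iter n.+1 x + sqrt_iter n.+1 x = k x + sqrt_iter n (sqrt_iter n x).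
    by rewrite -scalerDl -rmorphD /= (_ : 2^-1 + 2^-1 = 1 :> R) ?scale1r//; lra.
  move: (sqrt_iter n.+1 x) (sqrt_iter n (sqrt_iter n x)) (sqrt_iter n (Y x)).
  move: (Y (Y x)) => s; move: (Y x) (k x) => b p a q r e.
  have -> : a - b + (a - b) = (p + q) - (b + b) by rewrite addrACA e opprD.
  have -> : (q - r) + (r - s) = q - s by rewrite addrA subrK.
  by rewrite opprB !opprD -!addrA addKr.
rewrite (le_trans (rnormD _ _))// rnormN.
have YnL : forall z, rnorm (sqrt_iter n z) <= rnorm z.
  move=> z; rewrite (le_trans (rnorm_sqrt_iter _ _))// ler_piMl ?rnorm_ge0//.
  by case/andP: (sqrt_rate_itv n).
have H1 : rnorm (sqrt_iter n.+1 x - Y x) <= 2 * rnorm x * n.+1%:R^-1.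
  rewrite (le_trans (YP x n.+1))// ler_wpM2l ?mulr_ge0 ?rnorm_ge0//.
  by rewrite lef_pV2 ?posrE ?ltr0Sn ?ler_nat.
have H2 := rnormD (sqrt_iter n.+1 x - Y x) (sqrt_iter n.+1 x - Y x).
have H3 := rnormD (sqrt_iter n (sqrt_iter n x - Y x)) (sqrt_iter n (Y x) - Y (Y x)).
have H4 := le_trans (YnL _) (YP x n).
have H5 := YP (Y x) n.
have H6 : 0 <= rnorm x * n.+1%:R^-1 by rewrite mulr_ge0 ?rnorm_ge0 ?invr_ge0.
have H7 : 0 <= rnorm (Y x) * n.+1%:R^-1 by rewrite mulr_ge0 ?rnorm_ge0 ?invr_ge0.
rewrite /M; move: H1 H2 H3 H4 H5 H6 H7; move: (n.+1%:R^-1 : R) => z.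
move=> *; nra.
Qed.

End SqrtIteration.

Lemma ReD (R : realType) (c d : R[i]) : complex.Re (c + d) = complex.Re c + complex.Re d.
Proof. by case: c; case: d. Qed.

Lemma ReN (R : realType) (c : R[i]) : complex.Re (- c) = - complex.Re c.
Proof. by case: c. Qed.

Lemma Re_conj (R : realType) (c : R[i]) : complex.Re (c^*)%R = complex.Re c.
Proof. by case: c. Qed.

Lemma conj_real (R : realType) (r : R) : (r%:C^*)%R = r%:C.
Proof. exact: conjc_real. Qed.

Lemma Re_realM (R : realType) (r : R) (c : R[i]) :
  complex.Re (r%:C * c) = r * complex.Re c.
Proof. by case: c => a b /=; rewrite mul0r subr0. Qed.

Lemma ge0_ReE (R : realType) (c : R[i]) : 0 <= c -> c = (complex.Re c)%:C.
Proof. by move=> c0; rewrite RRe_real// ger0_real. Qed.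

(** The discriminant argument behind every Cauchy-Schwarz inequality below, with a = |<x, y>|^2: s =
    1 / b is the optimal choice, and for b = 0 a large s forces a = 0. *)
Lemma quad_bound (R : realType) (a b M : R) : 0 <= a -> 0 <= b ->
  (forall s, 2 * s * a - s ^+ 2 * (a * b) <= M) -> a <= M * b.
Proof.
rewrite !le_eqVlt => /orP[/eqP<- b0 H|a0 /orP[/eqP <- H|b0 H]].
- by have M0 := H 0; rewrite -le_eqVlt mulr_ge0 ?le_eqVlt//; move: M0;
    rewrite !(mulr0,mul0r) subr0 -le_eqVlt.
- have := H ((M + 1) / (2 * a)); rewrite !mulr0 subr0.
  have -> : 2 * ((M + 1) / (2 * a)) * a = M + 1 by field; rewrite gt_eqF.
  by move=> h; lra.
- have := H b^-1; rewrite -le_eqVlt -ler_pdivrMr//.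
  have -> : 2 * b^-1 * a - b^-1 ^+ 2 * (a * b) = a / b by field; rewrite gt_eqF.
  exact.
Qed.

(** * The Hilbert space of a semi-inner product *)

(** The form is only semidefinite because the GNS form phi(b^* a) can have null vectors. *)
Record prehilbert (R : realType) := PreHilbert {
  pre_sort :> lmodType R[i] ;
  sform : pre_sort -> pre_sort -> R[i] ;
  sform_linear : forall y, scalar (sform^~ y) ;
  sform_conj : forall x y, sform x y = ((sform y x)^*)%R ;
  sform_ge0 : forall x, 0 <= sform x x
}.

Section Form.
Context (R : realType) (P : prehilbert R).
Implicit Types (x y z : P) (c : R[i]).

Definition qform x : R := complex.Re (sform x x).

Lemma qform_ge0 x : 0 <= qform x.
Proof. by rewrite -ler0c /qform -ge0_ReE// sform_ge0. Qed.

Lemma sformE x : sform x x = (qform x)%:C.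
Proof. by rewrite -ge0_ReE// sform_ge0. Qed.

Lemma sformDl x y z : sform (x + y) z = sform x z + sform y z.
Proof. by rewrite -[x in LHS]scale1r sform_linear mul1r. Qed.

Lemma sform0l z : sform 0 z = 0.
Proof. by apply: (addrI (sform 0 z)); rewrite -sformDl !addr0. Qed.

Lemma sformZl c x z : sform (c *: x) z = c * sform x z.
Proof. by rewrite -[_ *: _]addr0 sform_linear sform0l addr0. Qed.

Lemma sformDr x y z : sform z (x + y) = sform z x + sform z y.
Proof. by rewrite sform_conj sformDl rmorphD /= -!sform_conj. Qed.

Lemma sformZr c x z : sform z (c *: x) = (c^*)%R * sform z x.
Proof. by rewrite sform_conj sformZl rmorphM /= -sform_conj. Qed.

Lemma qformZ c x : qform (c *: x) = modulus c ^+ 2 * qform x.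
Proof. by rewrite /qform sformZl sformZr mulrA conjM_modulus Re_realM. Qed.

Lemma qformD x y : qform (x + y) = qform x + qform y + 2 * complex.Re (sform x y).
Proof.
rewrite /qform sformDl !sformDr !ReD [sform y x]sform_conj Re_conj; lra.
Qed.

Lemma qformN x : qform (- x) = qform x.
Proof. by rewrite -scaleN1r qformZ modulusN modulus_real normr1 expr1n mul1r. Qed.

Lemma qform_parallelogram x y :
  qform (x + y) + qform (x - y) = 2 * qform x + 2 * qform y.
Proof.
rewrite !qformD qformN -scaleN1r sformZr rmorphN rmorph1 mulN1r ReN; lra.
Qed.

Lemma sform_CS x y : modulus (sform x y) ^+ 2 <= qform x * qform y.
Proof.
apply: quad_bound; rewrite ?sqr_ge0 ?qform_ge0// => s.
have := qform_ge0 (x + (- s%:C * sform x y) *: y).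
rewrite qformD qformZ sformZr modulusM modulusN modulus_real exprMn.
rewrite real_normK ?num_real// rmorphM rmorphN /= conj_real -mulrA.
rewrite [(_^* * _)%R]mulrC conjM_modulus.
rewrite -rmorphN Re_realM /= => h; lra.
Qed.

End Form.

(** * The Hilbert space of bounded antilinear functionals *)

Section Antidual.
Context (R : realType) (P : prehilbert R).

(** A vector v enters as the functional x |-> <v, x>, so null vectors become 0 by themselves, and
    completeness comes from pointwise limits. *)
Record antidual := Antidual {
  antidual_fun :> P -> R[i] ;
  antidual_linear : forall c x y,
    antidual_fun (c *: x + y) = (c^*)%R * antidual_fun x + antidual_fun y ;
  antidual_bounded : exists2 M, 0 <= M & forall x,
    modulus (antidual_fun x) ^+ 2 <= M * qform x }.

Lemma antidualP (F G : antidual) : F =1 G -> F = G.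
Proof.
case: F => f f1 f2; case: G => g g1 g2 /= /funext fg; subst g.
by congr Antidual; exact: Prop_irrelevance.
Qed.

HB.instance Definition _ := gen_eqMixin antidual.
HB.instance Definition _ := gen_choiceMixin antidual.

Implicit Types (F G : antidual) (x y v w : P) (c : R[i]).

Lemma antidualD F x y : F (x + y) = F x + F y.
Proof. by rewrite -[x in LHS]scale1r antidual_linear rmorph1 mul1r. Qed.

Lemma antidual0 F : F 0 = 0.
Proof. by apply: (addrI (F 0)); rewrite -antidualD !addr0. Qed.

Lemma antidualZ F c x : F (c *: x) = (c^*)%R * F x.
Proof. by rewrite -[_ *: _]addr0 antidual_linear antidual0 addr0. Qed.

Lemma antidualN F x : F (- x) = - F x.
Proof. by rewrite -scaleN1r antidualZ rmorphN rmorph1 mulN1r. Qed.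

Lemma modulusD_sqr c d (M N q : R) : 0 <= M -> 0 <= N -> 0 <= q ->
  modulus c ^+ 2 <= M * q -> modulus d ^+ 2 <= N * q ->
  modulus (c + d) ^+ 2 <= (Num.sqrt M + Num.sqrt N) ^+ 2 * q.
Proof.
move=> M0 N0 q0 cM dN.
have h (z : R[i]) K : 0 <= K -> modulus z ^+ 2 <= K * q ->
    modulus z <= Num.sqrt K * Num.sqrt q.
  move=> K0 zK; rewrite -sqrtrM// -[leLHS]ger0_norm ?modulus_ge0//.
  by rewrite -sqrtr_sqr ler_wsqrtr.
rewrite -[q in leRHS]sqr_sqrtr// -exprMn ler_pXn2r ?nnegrE ?modulus_ge0 ?mulr_ge0 ?addr_ge0 ?sqrtr_ge0//.
by rewrite mulrDl (le_trans (modulusD _ _))// lerD// h.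
Qed.

Program Definition antidual_add F G := @Antidual (fun x => F x + G x) _ _.
Next Obligation. by move=> F G c x y /=; rewrite !antidual_linear mulrDr addrACA. Qed.
Next Obligation.
move=> F G; have [M M0 FM] := antidual_bounded F; have [N N0 GN] := antidual_bounded G.
exists ((Num.sqrt M + Num.sqrt N) ^+ 2); first exact: sqr_ge0.
by move=> x; apply: modulusD_sqr => //; exact: qform_ge0.
Qed.

Program Definition antidual_scale c F := @Antidual (fun x => c * F x) _ _.
Next Obligation. by move=> c F d x y /=; rewrite antidual_linear mulrDr mulrCA. Qed.
Next Obligation.
move=> c F; have [M M0 FM] := antidual_bounded F.
exists (modulus c ^+ 2 * M); first by rewrite mulr_ge0 ?sqr_ge0.
by move=> x; rewrite modulusM exprMn -[leRHS]mulrA ler_wpM2l ?sqr_ge0.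
Qed.

Program Definition antidual_zero := @Antidual (fun=> 0) _ _.
Next Obligation. by move=> c x y /=; rewrite mulr0 addr0. Qed.
Next Obligation.
by exists 0 => // x; rewrite modulus0 mul0r expr0n.
Qed.

Program Definition antidual_opp F := @Antidual (fun x => - F x) _ _.
Next Obligation. by move=> F c x y /=; rewrite antidual_linear opprD mulrN. Qed.
Next Obligation.
by move=> F; have [M M0 FM] := antidual_bounded F; exists M => // x; rewrite modulusN.
Qed.

Lemma antidual_addA : associative antidual_add.
Proof. by move=> F G H; apply: antidualP => x /=; rewrite addrA. Qed.
Lemma antidual_addC : commutative antidual_add.
Proof. by move=> F G; apply: antidualP => x /=; rewrite addrC. Qed.
Lemma antidual_add0 : left_id antidual_zero antidual_add.
Proof. by move=> F; apply: antidualP => x /=; rewrite add0r. Qed.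
Lemma antidual_addN : left_inverse antidual_zero antidual_opp antidual_add.
Proof. by move=> F; apply: antidualP => x /=; rewrite addNr. Qed.
HB.instance Definition _ := GRing.isZmodule.Build antidual
  antidual_addA antidual_addC antidual_add0 antidual_addN.

Lemma antidual_scaleA c d F :
  antidual_scale c (antidual_scale d F) = antidual_scale (c * d) F.
Proof. by apply: antidualP => x /=; rewrite mulrA. Qed.
Lemma antidual_scale1 : left_id 1 antidual_scale.
Proof. by move=> F; apply: antidualP => x /=; rewrite mul1r. Qed.
Lemma antidual_scaleDr : right_distributive antidual_scale +%R.
Proof. by move=> c F G; apply: antidualP => x /=; rewrite mulrDr. Qed.
Lemma antidual_scaleDl F : {morph antidual_scale^~ F : c d / c + d}.
Proof. by move=> c d; apply: antidualP => x /=; rewrite mulrDl. Qed.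
HB.instance Definition _ := GRing.Zmodule_isLmodule.Build R[i] antidual
  antidual_scaleA antidual_scale1 antidual_scaleDr antidual_scaleDl.

Lemma antidual_addE F G x : (F + G) x = F x + G x. Proof. by []. Qed.
Lemma antidual_oppE F x : (- F) x = - F x. Proof. by []. Qed.
Lemma antidual_scaleE c F x : (c *: F) x = c * F x. Proof. by []. Qed.

Program Definition embed (v : P) := @Antidual (sform v) _ _.
Next Obligation. by move=> v c x y; rewrite sformDr sformZr. Qed.
Next Obligation.
by move=> v; exists (qform v); [exact: qform_ge0|move=> x; exact: sform_CS].
Qed.

(* The Legendre transform of the quadratic form; it is the square of the dual
   norm, and the parallelogram law and the density of [embed] are immediate
   from this formula. *)
Definition legendre F : R := sup [set 2 * complex.Re (F v) - qform v | v in setT].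

Lemma legendre_ub F M : 0 <= M ->
  (forall x, modulus (F x) ^+ 2 <= M * qform x) ->
  forall v, 2 * complex.Re (F v) - qform v <= M.
Proof.
move=> M0 FM v; have := FM v; have := Re_le_modulus (F v).
have := ler_norm (complex.Re (F v)); have := qform_ge0 v; have := modulus_ge0 (F v).
move: (modulus _) (complex.Re _) (qform v) (`|_|) => m r q a m0 q0 ra am mq.
suff : 2 * m <= q + M by lra.
rewrite -(ler_pXn2r (ltn0Sn 1)) ?nnegrE; [|lra|lra].
have := sqr_ge0 (q - M); nra.
Qed.

Lemma legendre_le F M :
  (forall v, 2 * complex.Re (F v) - qform v <= M) -> legendre F <= M.
Proof.
move=> FM; apply: ge_sup; first by exists (2 * complex.Re (F 0) - qform (0 : P));
  exists 0.
by move=> _ [v _ <-].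
Qed.

Lemma le_legendre F v : 2 * complex.Re (F v) - qform v <= legendre F.
Proof.
apply: ub_le_sup; last by exists v.
have [M M0 FM] := antidual_bounded F; exists M => _ [w _ <-].
exact: legendre_ub.
Qed.

Lemma legendre_ge0 F : 0 <= legendre F.
Proof. by have := le_legendre F 0; rewrite antidual0 /qform sform0l mulr0 subr0. Qed.

Lemma antidual_CS F v : modulus (F v) ^+ 2 <= legendre F * qform v.
Proof.
apply: quad_bound; rewrite ?sqr_ge0 ?qform_ge0// => s.
(* Among the multiples of v, those by s F(v) make F real and nonnegative, which leaves the quadratic
   in s of [quad_bound]. *)
have := le_legendre F ((s%:C * F v) *: v).
rewrite antidualZ qformZ modulusM modulus_real exprMn real_normK ?num_real//.
rewrite rmorphM /= conj_real -mulrA [(_^* * _)%R]mulrC conjM_modulus.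
by rewrite Re_realM /= !mulrA.
Qed.

Lemma legendre_bound F M : 0 <= M ->
  (forall x, modulus (F x) ^+ 2 <= M * qform x) -> legendre F <= M.
Proof. by move=> M0 FM; apply: legendre_le; exact: legendre_ub. Qed.

Lemma legendreZ c F : legendre (c *: F) = modulus c ^+ 2 * legendre F.
Proof.
have le d G : legendre (d *: G) <= modulus d ^+ 2 * legendre G.
  apply: legendre_bound; first by rewrite mulr_ge0 ?sqr_ge0 ?legendre_ge0.
  by move=> x; rewrite modulusM exprMn -[leRHS]mulrA ler_wpM2l ?sqr_ge0// antidual_CS.
apply/eqP; rewrite eq_le le /=; have [->|c0] := eqVneq c 0.
  by rewrite modulus0 expr0n mul0r legendre_ge0.
have m0 : 0 < modulus c.
  by rewrite lt_neqAle modulus_ge0 andbT eq_sym; apply: contra_neq c0 => /modulus_eq0.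
have := le c^-1 (c *: F); rewrite scalerA mulVf// scale1r.
have -> : modulus c^-1 = (modulus c)^-1.
  apply: (mulfI (lt0r_neq0 m0)); rewrite -modulusM !mulfV// ?lt0r_neq0//.
  by rewrite modulus_real normr1.
by rewrite exprVn mulrC ler_pdivlMr ?exprn_gt0// mulrC.
Qed.

Lemma legendreN F : legendre (- F) = legendre F.
Proof. by rewrite -scaleN1r legendreZ modulusN modulus_real normr1 expr1n mul1r. Qed.

(** Test vectors v for F + G and w for F - G yield (v + w) / 2 for F and (v - w) / 2 for G. This
    gives one inequality; applied to F + G and F - G it gives the other. *)
Lemma legendre_parallelogram F G :
  legendre (F + G) + legendre (F - G) = 2 * legendre F + 2 * legendre G.
Proof.
have le F' G' : legendre (F' + G') + legendre (F' - G') <= 2 * legendre F' + 2 * legendre G'.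
  rewrite -lerBrDr; apply: legendre_le => v; rewrite lerBrDr -lerBrDl.
  apply: legendre_le => w; rewrite lerBrDl.
  have := le_legendre F' ((2^-1)%:C *: (v + w)).
  have := le_legendre G' ((2^-1)%:C *: (v - w)).
  have := qform_parallelogram v w.
  rewrite !qformZ !antidualZ !modulus_real.
  rewrite !conj_real !Re_realM !antidualD !antidualN ger0_norm ?invr_ge0// !ReD !ReN.
  move: (qform (v + w)) (qform (v - w)) (qform v) (qform w) => a b c d.
  by move=> *; lra.
apply/eqP; rewrite eq_le le /=.
have := le (F + G) (F - G).
have -> : F + G + (F - G) = 2%:C *: F.
  by rewrite addrACA subrr addr0 -[in LHS](scale1r F) -scalerDl -rmorphD.
have -> : F + G - (F - G) = 2%:C *: G.
  by rewrite opprB addrC addrA subrK -[in LHS](scale1r G) -scalerDl -rmorphD.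
by rewrite !legendreZ !modulus_real ger0_norm// => h; lra.
Qed.

(** Translating the test vector by v: the squared distance from F to v is at most what v misses of
    the supremum. *)
Lemma legendre_embed F v :
  legendre (F - embed v) <= legendre F - (2 * complex.Re (F v) - qform v).
Proof.
apply: legendre_le => w; rewrite antidual_addE antidual_oppE ReD ReN /=.
have := le_legendre F (w + v); rewrite antidualD ReD qformD.
by rewrite sform_conj Re_conj => h; lra.
Qed.

Lemma legendre_dense F (e : R) : 0 < e -> exists v, legendre (F - embed v) < e.
Proof.
move=> e0; have [|_ [v _ <-] h] := @sup_adherent _ _ e e0 (_ : has_sup
    [set 2 * complex.Re (F v) - qform v | v in setT]).
  split; first by exists (2 * complex.Re (F 0) - qform (0 : P)); exists 0.
  by exists (legendre F) => _ [v _ <-]; exact: le_legendre.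
exists v; apply: (le_lt_trans (legendre_embed _ _)).
by move: h; rewrite -/(legendre F); lra.
Qed.

Definition antidual_norm F : R[i] := (Num.sqrt (legendre F))%:C.

Lemma antidual_normD F G :
  antidual_norm (F + G) <= antidual_norm F + antidual_norm G.
Proof.
rewrite /antidual_norm -rmorphD lecR -[leRHS]ger0_norm ?addr_ge0 ?sqrtr_ge0//.
rewrite -sqrtr_sqr ler_wsqrtr// legendre_bound ?sqr_ge0// => x.
by apply: modulusD_sqr; rewrite ?legendre_ge0 ?qform_ge0 ?antidual_CS.
Qed.

Lemma antidual_normZ c F : antidual_norm (c *: F) = `|c| * antidual_norm F.
Proof.
rewrite /antidual_norm legendreZ sqrtrM ?sqr_ge0// sqrtr_sqr modulusE -rmorphM.
by rewrite ger0_norm ?modulus_ge0.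
Qed.

Lemma antidual_norm_eq0 F : antidual_norm F = 0 -> F = 0.
Proof.
move=> /complexI/eqP; rewrite sqrtr_eq0 => F0; apply: antidualP => x.
apply: modulus_eq0; apply/eqP; rewrite -sqrf_eq0 eq_le sqr_ge0 andbT.
by rewrite (le_trans (antidual_CS _ _))// mulr_le0_ge0 ?qform_ge0.
Qed.

HB.instance Definition _ := @Lmodule_isNormed.Build R[i] antidual
  antidual_norm antidual_normD antidual_normZ antidual_norm_eq0.

Lemma rnorm_antidual F : rnorm F = Num.sqrt (legendre F).
Proof. by []. Qed.

Lemma sqr_rnorm_antidual F : rnorm F ^+ 2 = legendre F.
Proof. by rewrite rnorm_antidual sqr_sqrtr ?legendre_ge0. Qed.

End Antidual.

Section AntidualComplete.
Context (R : realType) (P : prehilbert R).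
Implicit Types (F G : antidual P) (v w : P).

Lemma antidual_modulus F v : modulus (F v) <= rnorm F * Num.sqrt (qform v).
Proof.
rewrite rnorm_antidual -sqrtrM ?legendre_ge0// -[leLHS]ger0_norm ?modulus_ge0//.
by rewrite -sqrtr_sqr ler_wsqrtr// antidual_CS.
Qed.

Lemma rnorm_antidual_le F (M : R) : 0 <= M ->
  (forall v, modulus (F v) <= M * Num.sqrt (qform v)) -> rnorm F <= M.
Proof.
move=> M0 FM; rewrite rnorm_antidual -[leRHS]ger0_norm// -sqrtr_sqr ler_wsqrtr//.
apply: legendre_bound; first exact: sqr_ge0.
move=> v; rewrite -[qform v]sqr_sqrtr ?qform_ge0// -exprMn.
by rewrite ler_pXn2r ?nnegrE ?modulus_ge0 ?mulr_ge0 ?sqrtr_ge0.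
Qed.

Lemma rnorm_embed v : rnorm (embed v) = Num.sqrt (qform v).
Proof.
apply/eqP; rewrite eq_le rnorm_antidual_le ?sqrtr_ge0//=; last first.
  by move=> w; rewrite -sqrtrM ?qform_ge0// -[leLHS]ger0_norm ?modulus_ge0//
    -sqrtr_sqr ler_wsqrtr// sform_CS.
rewrite rnorm_antidual ler_wsqrtr//.
have := le_legendre (embed v) v; rewrite /= sformE /=; lra.
Qed.

Lemma antidual_complete (Phi : set_system (antidual P)) :
  ProperFilter Phi -> cauchy Phi -> cvg Phi.
Proof.
move=> PF /cauchyP Phic.
(* The Cauchy filter is replaced by centres of balls of radius 1 / (n + 1) that belong to it; any
   two such balls meet, which gives the rate. *)
have /choice[u uP] : forall n : nat, exists F, Phi (ball F ((n.+1%:R^-1 : R)%:C)).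
  by move=> n; apply: Phic; rewrite ltcR invr_gt0.
have uC n m : rnorm (u n - u m) <= n.+1%:R^-1 + m.+1%:R^-1.
  have [F []] := filter_ex (filterI (uP n) (uP m)).
  rewrite -!ball_normE /= !rnormE !ltcR => Fn Fm.
  rewrite (le_trans (rnorm_triangle _ F _))// lerD ?ltW//.
  by rewrite rnormBC.
have /choice[L LP] : forall v, exists l, forall n,
    modulus (u n v - l) <= (Num.sqrt (qform v) + Num.sqrt (qform v)) * n.+1%:R^-1.
  move=> v; apply: complex_complete_seq => n m; rewrite -antidual_oppE -antidual_addE.
  rewrite (le_trans (antidual_modulus _ _))// -mulrDr mulrC ler_wpM2l ?sqrtr_ge0//.
have Llin c x y : L (c *: x + y) = (c^*)%R * L x + L y.
  apply/subr0_eq/modulus_eq0/eqP; rewrite eq_le modulus_ge0 andbT.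
  pose s x := Num.sqrt (qform (x : P)).
  pose M := (s (c *: x + y) + s (c *: x + y)) + modulus c * (s x + s x) + (s y + s y).
  apply: (@le0_inv_nat _ M) => n.
  have -> : L (c *: x + y) - ((c^*)%R * L x + L y) =
    - (u n (c *: x + y) - L (c *: x + y)) + ((c^*)%R * (u n x - L x) + (u n y - L y)).
    by rewrite antidual_linear; ring.
  rewrite (le_trans (modulusD _ _))// modulusN /M -addrA mulrDl lerD//.
  rewrite (le_trans (modulusD _ _))// mulrDl lerD// modulusM modulus_conj -mulrA.
  by rewrite ler_wpM2l ?modulus_ge0.
have Lbnd : exists2 M, 0 <= M & forall x, modulus (L x) ^+ 2 <= M * qform x.
  (* The approximation at n = 0 is enough: it is off by at most 2 sqrt (q x). *)
  exists ((rnorm (u 0%N) + 2) ^+ 2); first exact: sqr_ge0.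
  move=> x; rewrite -[qform x]sqr_sqrtr ?qform_ge0// -exprMn.
  rewrite ler_pXn2r ?nnegrE ?modulus_ge0 ?mulr_ge0 ?addr_ge0 ?rnorm_ge0 ?sqrtr_ge0//.
  have := LP x 0%N; rewrite invr1 mulr1 modulusBC.
  have := modulusD (L x - u 0%N x) (u 0%N x); rewrite subrK.
  by have := antidual_modulus (u 0%N) x; lra.
pose F := Antidual Llin Lbnd.
have uF n : rnorm (u n - F) <= 2 * n.+1%:R^-1.
  apply: rnorm_antidual_le; first by rewrite mulr_ge0.
  by move=> v; rewrite antidual_addE antidual_oppE (le_trans (LP v n))// mulrAC mulr_natl mulr2n.
apply/cvg_ex; exists F; apply/cvgrPdist_lt => e e0.
have /complex_realP[r er] : e \is Num.real by rewrite gtr0_real.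
move: e0; rewrite er ltcR => r0.
have r3 : 0 < r / 3 by rewrite divr_gt0.
have [n nr] := inv_nat_lt r3.
apply: filterS (uP n) => G; rewrite -ball_normE /= !rnormE !ltcR => unG.
apply: (le_lt_trans (rnorm_triangle _ (u n) _)).
have := uF n; rewrite rnormBC; move: unG nr; move: (n.+1%:R^-1 : R) => z.
by move=> *; lra.
Qed.

HB.instance Definition _ := Uniform_isComplete.Build (antidual P) antidual_complete.

(** The real part of the inner product, recovered from the norm by polarization. *)
Definition polar F G : R :=
  (rnorm (F + G) ^+ 2 - rnorm F ^+ 2 - rnorm G ^+ 2) / 2.

Lemma rnorm_parallelogram F G : rnorm (F + G) ^+ 2 + rnorm (F - G) ^+ 2 =
  2 * rnorm F ^+ 2 + 2 * rnorm G ^+ 2.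
Proof. by rewrite !sqr_rnorm_antidual legendre_parallelogram. Qed.

Lemma polarC F G : polar F G = polar G F.
Proof. by rewrite /polar [G + F]addrC; lra. Qed.

(* The Jordan-von Neumann argument. *)
Lemma polarDl F F' G : polar (F + F') G = polar F G + polar F' G.
Proof.
rewrite /polar.
have h1 := rnorm_parallelogram (F + G) F'.
have h2 := rnorm_parallelogram F (G - F').
have h3 := rnorm_parallelogram (F + F') G.
have h4 := rnorm_parallelogram G F'.
move: h1 h2 h3 h4; rewrite [G + F']addrC opprB !addrA.
rewrite [F + G + F']addrAC [F + F' - G]addrAC.
by move=> *; lra.
Qed.

Lemma polarDr F G G' : polar F (G + G') = polar F G + polar F G'.
Proof. by rewrite polarC polarDl ![polar _ F]polarC. Qed.

Lemma polar0l G : polar 0 G = 0.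
Proof. by apply: (addrI (polar 0 G)); rewrite -polarDl !addr0. Qed.

Lemma polarNl F G : polar (- F) G = - polar F G.
Proof. by apply/eqP; rewrite -addr_eq0 -polarDl addNr polar0l. Qed.

Lemma polar_le F G : `|polar F G| <= rnorm F * rnorm G.
Proof.
have le F' G' : polar F' G' <= rnorm F' * rnorm G'.
  rewrite /polar ler_pdivrMr//.
  have := rnormD F' G'; have := rnorm_ge0 (F' + G').
  have := rnorm_ge0 F'; have := rnorm_ge0 G'.
  by move: (rnorm _) (rnorm F') (rnorm G') => a b c *; nra.
by rewrite ler_norml le andbT lerNl -polarNl (le_trans (le _ _))// rnormN.
Qed.

(** [legendre_embed] at - G bounds the polarization from above; replacing F by - F reverses the
    bound. *)
Lemma polar_embed F v : polar F (embed v) = complex.Re (F v).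
Proof.
have le G : polar G (embed v) <= complex.Re (G v).
  have lv : legendre (embed v) = qform v.
    by rewrite -sqr_rnorm_antidual rnorm_embed sqr_sqrtr ?qform_ge0.
  have := legendre_embed (- G) v; rewrite -opprD !legendreN.
  have -> : (- G) v = - G v by [].
  by rewrite ReN /polar !sqr_rnorm_antidual lv ler_pdivrMr// => h; lra.
apply/eqP; rewrite eq_le le /= -[leRHS]opprK -polarNl lerNr.
have -> : - complex.Re (F v) = complex.Re ((- F) v) by rewrite -ReN.
exact: le.
Qed.

(** With linearity in the first variable, <F, i G> = - i <F, G>, and its real part is the imaginary
    part of <F, G>. *)
Definition dot F G : R[i] := polar F G +i* polar F ('i%C *: G).

Lemma dot_embed F v : dot F (embed v) = F v.
Proof.
rewrite /dot polar_embed.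
have -> : 'i%C *: embed v = embed ('i%C *: v).
  by apply: antidualP => x; apply/esym; exact: sformZl.
rewrite polar_embed antidualZ; case: (F v) => a b /=.
by congr (_ +i* _); lra.
Qed.

Lemma dotDl F F' G : dot (F + F') G = dot F G + dot F' G.
Proof. by rewrite /dot !polarDl. Qed.

Lemma dotDr F G G' : dot F (G + G') = dot F G + dot F G'.
Proof. by rewrite /dot scalerDr !polarDr. Qed.

Lemma dot_le F G : modulus (dot F G) <= 2 * (rnorm F * rnorm G).
Proof.
rewrite (le_trans (modulus_le _))//= mulr_natl mulr2n lerD// ?polar_le//.
rewrite (le_trans (polar_le _ _))// rnormZ.
have -> : modulus ('i%C : R[i]) = 1.
  by rewrite /modulus normc_def /= expr0n expr1n add0r sqrtr1.
by rewrite mul1r.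
Qed.

Lemma embed_dense F (e : R) : 0 < e -> exists v, rnorm (F - embed v) < e.
Proof.
move=> e0; have [v ve] := legendre_dense F (exprn_gt0 2 e0); exists v.
by rewrite -(ltr_pXn2r (ltn0Sn 1)) ?nnegrE ?rnorm_ge0 ?ltW// sqr_rnorm_antidual.
Qed.

(** Identities for [dot] are checked on embedded vectors, where [dot] is evaluation, and extended by
    density. Additivity is the form asked of D because the homogeneity of [dot] is itself proved
    this way. *)
Lemma eq0_on_embed (D : antidual P -> R[i]) (K : R) :
  (forall F G, D (F + G) = D F + D G) ->
  (forall F, modulus (D F) <= K * rnorm F) ->
  (forall v, D (embed v) = 0) -> forall F, D F = 0.
Proof.
move=> DD DK D0 F; apply/modulus_eq0/eqP; rewrite eq_le modulus_ge0 andbT.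
apply: (@le0_inv_nat _ `|K|) => n.
have [v vn] := @embed_dense F n.+1%:R^-1 ltac:(by rewrite invr_gt0).
have := DD (F - embed v) (embed v); rewrite subrK D0 addr0 => ->.
rewrite (le_trans (DK _))// (le_trans (ler_norm _))// normrM [`|rnorm _|]ger0_norm ?rnorm_ge0//.
by rewrite ler_wpM2l// ltW.
Qed.

Lemma dotZl c F G : dot (c *: F) G = c * dot F G.
Proof.
apply/subr0_eq; pose D G := dot (c *: F) G - c * dot F G.
apply: (@eq0_on_embed D (2 * rnorm (c *: F) + modulus c * (2 * rnorm F))).
- by move=> H H'; rewrite /D !dotDr; ring.
- move=> H; rewrite (le_trans (modulusD _ _))// modulusN mulrDl lerD//.
    by rewrite -mulrA dot_le.
  by rewrite modulusM -!mulrA ler_wpM2l ?modulus_ge0// dot_le.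
- by move=> v; rewrite /D !dot_embed antidual_scaleE subrr.
Qed.

Lemma dotC F G : dot F G = ((dot G F)^*)%R.
Proof.
have e0 v H : dot (embed v) H = ((H v)^*)%R.
  rewrite /dot polarC polar_embed polarC polar_embed antidual_scaleE.
  by case: (H v) => a b /=; congr (_ +i* _); lra.
apply/subr0_eq; pose D F := dot F G - ((dot G F)^*)%R.
apply: (@eq0_on_embed D (2 * rnorm G + 2 * rnorm G)).
- by move=> H H'; rewrite /D dotDr dotDl rmorphD /=; ring.
- move=> H; rewrite (le_trans (modulusD _ _))// modulusN modulus_conj mulrDl lerD//.
    by rewrite -mulrA [rnorm G * _]mulrC dot_le.
  by rewrite -mulrA dot_le.
- by move=> v; rewrite /D e0 dot_embed subrr.
Qed.

Lemma dot_norm F : dot F F = ((rnorm F) ^+ 2)%:C.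
Proof.
have := dotC F F; rewrite /dot; move: (polar F ('i%C *: F)) => p [im].
congr (_ +i* _); last lra.
rewrite /polar; have -> : F + F = 2%:C *: F.
  by rewrite -[in LHS](scale1r F) -scalerDl -rmorphD.
rewrite rnormZ modulus_real ger0_norm// exprMn; lra.
Qed.

Lemma dot_linear : bilinear_for (GRing.Scale.Law.clone R[i] R[i] *%R _)
  (GRing.Scale.Law.clone R[i] R[i] (@Num.conj R[i] \; *%R) _) dot.
Proof.
split=> [G c F F'|F c G G'].
  by rewrite dotDl dotZl.
by rewrite dotDr dotC dotZl rmorphM /= -dotC.
Qed.

Lemma dot_herm F G : dot F G = (-1) ^+ false * Num.conj (dot G F).
Proof. by rewrite expr0 mul1r dotC. Qed.

Lemma dot_gt0 F : F != 0 -> 0 < dot F F.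
Proof.
move=> F0; rewrite dot_norm ltcR exprn_gt0// lt_neqAle rnorm_ge0 andbT eq_sym.
by apply: contra_neq F0; exact: rnorm_eq0.
Qed.

HB.instance Definition _ := @bilinear_isBilinear.Build R[i] (antidual P)
  (antidual P) R[i] _ _ dot dot_linear.
HB.instance Definition _ := @isHermitianSesquilinear.Build R[i] (antidual P)
  false Num.conj dot dot_herm.
HB.instance Definition _ := @isDotProduct.Build R[i] (antidual P) dot dot_gt0.

Lemma dot_inner_norm F : dot F F = `|F| ^+ 2.
Proof. by rewrite dot_norm rnormE rmorphXn. Qed.

HB.instance Definition _ := @isHilbert.Build R (antidual P) dot dot_inner_norm.

End AntidualComplete.

(** * Hilbert space geometry and bounded operators *)

Section Hilbert.
Context (R : realType) (H : hilbertType R).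
Implicit Types (x y z : H) (c : R[i]).

Lemma innerDl x y z : inner (x + y) z = inner x z + inner y z.
Proof. exact: linearDl. Qed.

Lemma innerZl c x z : inner (c *: x) z = c * inner x z.
Proof. exact: linearZl_LR. Qed.

Lemma innerC x y : inner x y = ((inner y x)^*)%R.
Proof. by rewrite hermC expr0 mul1r. Qed.

Lemma innerDr x y z : inner z (x + y) = inner z x + inner z y.
Proof. exact: linearDr. Qed.

Lemma innerZr c x z : inner z (c *: x) = (c^*)%R * inner z x.
Proof. exact: linearZr_LR. Qed.

Lemma innerNl x z : inner (- x) z = - inner x z.
Proof. exact: linearNl. Qed.

Lemma innerNr x z : inner z (- x) = - inner z x.
Proof. exact: linearNr. Qed.

Lemma inner0l z : inner 0 z = 0.
Proof. exact: linear0l. Qed.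

Lemma inner0r z : inner z 0 = 0.
Proof. exact: linear0r. Qed.

Lemma innerE x : inner x x = (rnorm x ^+ 2)%:C.
Proof. by rewrite inner_norm rnormE rmorphXn. Qed.

Lemma inner_scalar y : scalar (fun x : H => inner x y).
Proof. by move=> c a b; rewrite innerDl innerZl. Qed.

Lemma inner_ge0 x : 0 <= inner x x.
Proof. by rewrite innerE ler0c sqr_ge0. Qed.

Definition hilbert_prehilbert : prehilbert R :=
  @PreHilbert R H (fun x y => inner x y) inner_scalar innerC inner_ge0.

Lemma qform_hilbert x : @qform R hilbert_prehilbert x = rnorm x ^+ 2.
Proof. by rewrite /qform /= innerE. Qed.

Lemma inner_CS x y : modulus (inner x y) <= rnorm x * rnorm y.
Proof.
have := @sform_CS R hilbert_prehilbert x y; rewrite !qform_hilbert -exprMn.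
by rewrite ler_pXn2r ?nnegrE ?modulus_ge0 ?mulr_ge0 ?rnorm_ge0.
Qed.

Lemma rnormD_sqr x y :
  rnorm (x + y) ^+ 2 = rnorm x ^+ 2 + rnorm y ^+ 2 + 2 * complex.Re (inner x y).
Proof. by rewrite -!qform_hilbert (@qformD R hilbert_prehilbert). Qed.

Lemma rnormB_sqr x y :
  rnorm (x - y) ^+ 2 = rnorm x ^+ 2 + rnorm y ^+ 2 - 2 * complex.Re (inner x y).
Proof. by rewrite rnormD_sqr rnormN innerNr ReN mulrN. Qed.

Lemma parallelogram x y : rnorm (x + y) ^+ 2 + rnorm (x - y) ^+ 2 =
  2 * rnorm x ^+ 2 + 2 * rnorm y ^+ 2.
Proof. by rewrite rnormD_sqr rnormB_sqr; lra. Qed.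

Lemma inner_eq0 x : inner x x = 0 -> x = 0.
Proof.
rewrite innerE => /complexI/eqP; rewrite expf_eq0 /= => /eqP; exact: rnorm_eq0.
Qed.

(** First-order condition at a minimum, as [quad_bound] with M = 0 along c = s <x, y>. *)
Lemma orthogonal_min x y (d : R) :
  (forall c, d <= rnorm (x - c *: y) ^+ 2) -> rnorm x ^+ 2 <= d -> inner x y = 0.
Proof.
move=> Hd xd; apply: modulus_eq0; apply/eqP; rewrite -sqrf_eq0 eq_le sqr_ge0 andbT.
rewrite -[leRHS](mul0r (rnorm y ^+ 2)).
apply: quad_bound; rewrite ?sqr_ge0// => s.
have := Hd (s%:C * inner x y); rewrite rnormB_sqr rnormZ modulusM modulus_real.
rewrite !exprMn real_normK ?num_real// innerZr rmorphM /= conj_real.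
rewrite -[X in complex.Re X]mulrA -mulrA.
by rewrite [(_^* * _)%R]mulrC conjM_modulus Re_realM /= => h; lra.
Qed.

Lemma projection (S : set H) x : closed_subspace S ->
  exists2 s, S s & forall t, S t -> inner (x - s) t = 0.
Proof.
move=> [S0 SP Sc].
pose D := [set rnorm (x - s) ^+ 2 | s in S].
have D0 : has_inf D.
  split; first by exists (rnorm (x - 0) ^+ 2); exists 0.
  by exists 0 => _ [s _ <-]; exact: sqr_ge0.
have infle s : S s -> inf D <= rnorm (x - s) ^+ 2.
  by move=> Ss; apply: ge_inf; [case: D0|exists s].
(* The excess is squared so that the parallelogram law yields distances of order 1 / (n + 1), the
   rate that [complete_seq] asks for. *)
have /choice[u uP] : forall n : nat, exists s, S s /\
    rnorm (x - s) ^+ 2 <= inf D + (n.+1%:R^-1) ^+ 2.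
  move=> n; have e0 : 0 < (n.+1%:R^-1 : R) ^+ 2 by rewrite exprn_gt0// invr_gt0.
  by have [_ [s Ss <-] lt] := inf_adherent e0 D0; exists s; split=> //; exact: ltW.
have SB s t : S s -> S t -> S (s - t).
  by move=> Ss St; rewrite addrC -scaleN1r; exact: SP.
have half s t : S s -> S t -> S ((2^-1)%:C *: (s + t)).
  move=> Ss St; rewrite -[_ *: _]addr0; apply: (SP) => //.
  by rewrite -[s]scale1r; exact: SP.
have uC n m : rnorm (u n - u m) <= 2 * n.+1%:R^-1 + 2 * m.+1%:R^-1.
  have [Sn un] := uP n; have [Sm um] := uP m.
  have a0 : 0 <= n.+1%:R^-1 :> R by rewrite invr_ge0.
  have b0 : 0 <= m.+1%:R^-1 :> R by rewrite invr_ge0.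
  rewrite -(ler_pXn2r (ltn0Sn 1)) ?nnegrE ?rnorm_ge0 ?addr_ge0 ?mulr_ge0//.
  have := parallelogram (x - u n) (x - u m).
  have -> : x - u n - (x - u m) = u m - u n by rewrite opprB addrC addrA subrK.
  have -> : x - u n + (x - u m) = 2%:C *: (x - (2^-1)%:C *: (u n + u m)).
    rewrite scalerBr scalerA -rmorphM mulfV// scale1r opprD addrACA; congr (_ + _).
    by rewrite -[in LHS](scale1r x) -scalerDl -rmorphD.
  rewrite rnormZ modulus_real ger0_norm// exprMn [rnorm (u m - u n)]rnormBC.
  have := infle _ (half _ _ Sn Sm); move: un um a0 b0.
  move: (n.+1%:R^-1 : R) (m.+1%:R^-1 : R) (inf D) => a b d.
  by move=> *; nra.
have [s us] := complete_seq uC.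
have Ss : S s.
  rewrite (closure_id S).1//; apply/closureP => e e0.
  have e2 : 0 < e / 2 by rewrite divr_gt0.
  have [n ne] := inv_nat_lt e2; exists (u n); first by case: (uP n).
  by rewrite rnormBC (le_lt_trans (us n))// mulrC -ltr_pdivlMr.
exists s => // t St; apply: (@orthogonal_min _ _ (inf D)).
  move=> c; rewrite -addrA -opprD; apply: infle.
  by rewrite addrC; exact: SP.
rewrite -subr_le0; pose K := 1 + 4 * rnorm (x - s) + 4 + 4.
apply: (@le0_inv_nat _ K) => n; have [Sn un] := uP n; have := us n.
have := rnorm_triangle x (u n) s; move: un; have := rnorm_ge0 (x - u n).
have := rnorm_ge0 (x - s); have := rnorm_ge0 (u n - s).
have : n.+1%:R^-1 <= 1 :> R by rewrite invf_le1 ?ler1n.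
have : 0 < n.+1%:R^-1 :> R by rewrite invr_gt0.
rewrite /K; move: (n.+1%:R^-1 : R) (rnorm (x - s)) (rnorm (x - u n)) (rnorm (u n - s)) (inf D).
move=> e a b f d e0 e1 f0 a0 b0 bd ab fe.
have [ba|ab'] := leP a b.
  by nra.
have : (a - b) * (a + b) <= 2 * e * (2 * a) by apply: ler_pM; lra.
by nra.
Qed.

End Hilbert.

Lemma linearZ_of (R : pzRingType) (U V : lmodType R) (f : U -> V) : linear f ->
  forall c x, f (c *: x) = c *: f x.
Proof. by move=> fl c x; rewrite (scalable_linear fl). Qed.

Lemma linearD_of (R : pzRingType) (U V : lmodType R) (f : U -> V) : linear f ->
  forall x y, f (x + y) = f x + f y.
Proof. by move=> fl x y; rewrite -[x in LHS]scale1r fl scale1r. Qed.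

Lemma linear0_of (R : pzRingType) (U V : lmodType R) (f : U -> V) : linear f ->
  f 0 = 0.
Proof. by move=> fl; rewrite -(scale0r 0) linearZ_of// scale0r. Qed.

Lemma linearN_of (R : pzRingType) (U V : lmodType R) (f : U -> V) : linear f ->
  forall x, f (- x) = - f x.
Proof. by move=> fl x; rewrite -scaleN1r linearZ_of// scaleN1r. Qed.

Lemma linearB_of (R : pzRingType) (U V : lmodType R) (f : U -> V) : linear f ->
  forall x y, f (x - y) = f x - f y.
Proof. by move=> fl x y; rewrite linearD_of// linearN_of. Qed.

Lemma isometry_inner (R : realType) (H K : hilbertType R) (U : H -> K) : linear U ->
  (forall x, rnorm (U x) = rnorm x) -> forall x y, inner (U x) (U y) = inner x y.
Proof.
move=> Ul Un.
have re x y : complex.Re (inner (U x) (U y)) = complex.Re (inner x y).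
  have := rnormD_sqr (U x) (U y); rewrite -linearD_of// !Un rnormD_sqr => h; lra.
move=> x y; have := re x y; have := re (- 'i%C *: x) y.
rewrite linearZ_of// !innerZl; case: (inner x y); case: (inner (U x) _) => a b c d /=.
by rewrite oppr0 !mul0r !mulN1r !opprK !add0r => -> ->.
Qed.

Lemma linear_bounded_cont (R : realType) (V W : normedModType R[i]) (f : V -> W)
  (K : R) : linear f -> (forall x, rnorm (f x) <= K * rnorm x) -> continuous f.
Proof.
move=> fl fK x; apply/cvgrPdist_lt => e e0.
have /complex_realP[r er] : e \is Num.real by rewrite gtr0_real.
move: e0; rewrite er ltcR => r0.
have K0 : 0 < `|K| + 1 by rewrite ltr_wpDl.
apply/nbhs_ballP; exists ((r / (`|K| + 1))%:C); first by rewrite /= ltcR divr_gt0.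
move=> y; rewrite -ball_normE /= !rnormE !ltcR -linearB_of// => xy.
rewrite (le_lt_trans (fK _))// (@le_lt_trans _ _ ((`|K| + 1) * rnorm (x - y)))//.
  by rewrite ler_wpM2r ?rnorm_ge0// ler_wpDr// ler_norm.
by rewrite mulrC -ltr_pdivlMr.
Qed.

Lemma kernel_closed (R : realType) (V W : normedModType R[i]) (f : V -> W)
  (K : R) : linear f -> (forall x, rnorm (f x) <= K * rnorm x) ->
  closed [set x | f x = 0].
Proof.
move=> fl fK x /closureP xS /=; apply/rnorm_eq0/eqP.
rewrite eq_le rnorm_ge0 andbT; apply: (@le0_inv_nat _ `|K|) => n.
have n0 : 0 < n.+1%:R^-1 :> R by rewrite invr_gt0.
have [y /= fy xy] := xS _ n0.
have -> : f x = f (x - y) by rewrite linearB_of// fy subr0.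
rewrite (le_trans (fK _))// (@le_trans _ _ (`|K| * rnorm (x - y)))//.
  by rewrite ler_wpM2r ?rnorm_ge0// ler_norm.
by rewrite ler_wpM2l// ltW.
Qed.

Lemma isometry_range_closed (R : realType) (V : CompleteNormedModule.type R[i])
  (W : normedModType R[i]) (U : V -> W) : linear U ->
  (forall x, rnorm (U x) = rnorm x) -> closed (range U).
Proof.
move=> Ul Un y /closureP yS.
have /choice[u uP] : forall n : nat, exists x, rnorm (y - U x) <= n.+1%:R^-1.
  move=> n; have n0 : 0 < n.+1%:R^-1 :> R by rewrite invr_gt0.
  by have [_ [x _ <-] /ltW] := yS _ n0; exists x.
have [n m|x ux] := @complete_seq R V 1 u.
  rewrite !mul1r -Un linearB_of// (le_trans (rnorm_triangle _ y _))// lerD//.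
  by rewrite rnormBC.
exists x => //; apply/esym/subr0_eq/rnorm_eq0/eqP.
rewrite eq_le rnorm_ge0 andbT; apply: (@le0_inv_nat _ 2) => n.
rewrite (le_trans (rnorm_triangle _ (U (u n)) _))// -linearB_of// Un.
have := uP n; have := ux n; rewrite mul1r; move: (n.+1%:R^-1 : R) => z; lra.
Qed.

Lemma closed_subspace_kernel (R : realType) (H : hilbertType R)
  (W : normedModType R[i]) (f : H -> W)
  (K : R) : linear f -> (forall x, rnorm (f x) <= K * rnorm x) ->
  closed_subspace [set x | f x = 0].
Proof.
move=> fl fK; split => /=; first exact: linear0_of.
  by move=> c x y fx fy; rewrite fl fx fy scaler0 addr0.
exact: kernel_closed fl fK.
Qed.

(* 1 - Y is a square root of 1 - k. *)
Lemma sqrt_exists (R : realType) (V : CompleteNormedModule.type R[i]) (k : V -> V) :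
  linear k -> (forall x, rnorm (k x) <= rnorm x) ->
  exists Y : V -> V,
  [/\ linear Y, forall x, rnorm (Y x) <= rnorm x,
      forall x, Y x + Y x = k x + Y (Y x) &
      forall (b : V -> V) (K : R), linear b -> (forall x, rnorm (b x) <= K * rnorm x) ->
        (forall x, k (b x) = b (k x)) -> forall x, Y (b x) = b (Y x)].
Proof.
move=> kl k1; have [Y [YP Yl Y1 YE]] := sqrt_iter_lim kl k1.
exists Y; split=> // b K bl bK kb x.
(* The iterates are polynomials in k, so they commute with whatever commutes with k, and the limit
   inherits this. *)
have Yb n z : sqrt_iter k n (b z) = b (sqrt_iter k n z).
  elim: n z => [|n IH] z /=; first by rewrite linear0_of.
  by rewrite !IH kb -linearD_of// -linearZ_of.
apply/subr0_eq/rnorm_eq0/eqP.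
rewrite eq_le rnorm_ge0 andbT;
  apply: (@le0_inv_nat _ (2 * rnorm (b x) + `|K| * (2 * rnorm x))) => n.
rewrite (le_trans (rnorm_triangle _ (sqrt_iter k n (b x)) _))// mulrDl lerD//.
  by rewrite rnormBC.
rewrite Yb -linearB_of// (le_trans (bK _))//.
rewrite (@le_trans _ _ (`|K| * rnorm (sqrt_iter k n x - Y x)))//.
  by rewrite ler_wpM2r ?rnorm_ge0// ler_norm.
by rewrite -mulrA ler_wpM2l.
Qed.

(** * Positive functionals and the GNS construction *)

Section CStar.
Context (R : realType) (A : cstarType R).
Implicit Types (a b x y : A) (c : R[i]).

Lemma scaleAl c x y : c *: (x * y) = (c *: x) * y.
Proof. exact: cstar_scaleAl. Qed.

Lemma scaleAr c x y : c *: (x * y) = x * (c *: y).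
Proof. exact: cstar_scaleAr. Qed.

Lemma star_mul x y : star (x * y) = star y * star x.
Proof. exact: starM. Qed.

Lemma star0 : star (0 : A) = 0.
Proof. by apply: (addrI (star 0)); rewrite -starD !addr0. Qed.

Lemma starN x : star (- x) = - star x.
Proof. by apply/eqP; rewrite -addr_eq0 -starD addNr star0. Qed.

Lemma star_one : star (1 : A) = 1.
Proof. by rewrite -[LHS]mulr1 -[X in _ * X]starK -star_mul mulr1 starK. Qed.

Lemma rnormM x y : rnorm (x * y) <= rnorm x * rnorm y.
Proof. by rewrite -lecR rmorphM /= -!rnormE; exact: cstar_normM. Qed.

Lemma rnorm_starM x : rnorm (star x * x) = rnorm x ^+ 2.
Proof. by apply: complexI; rewrite rmorphXn /= -!rnormE; exact: cstar_norm. Qed.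

Lemma rnorm_star x : rnorm (star x) = rnorm x.
Proof.
have le y : rnorm y <= rnorm (star y).
  have [->|y0] := eqVneq (rnorm y) 0; first exact: rnorm_ge0.
  have y1 : 0 < rnorm y by rewrite lt_neqAle eq_sym y0 rnorm_ge0.
  by rewrite -(ler_pM2r y1) -expr2 -rnorm_starM rnormM.
by apply/eqP; rewrite eq_le le andbT -[in leRHS](starK x) le.
Qed.

(** The iteration runs on the Banach space A with k the left multiplication by h. Its iterates are
    left multiplications by selfadjoint elements, so the limit is left multiplication by the
    selfadjoint Y 1, and x = 1 - Y 1 works. *)
Lemma sqrt_one_sub h : star h = h -> rnorm h <= 1 ->
  exists x : A, star x * x = 1 - h.
Proof.
move=> hs h1.
have kl : linear (fun x => h * x) by move=> c x y; rewrite mulrDr -scaleAr.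
have k1 x : rnorm (h * x) <= rnorm x.
  by rewrite (le_trans (rnormM _ _))// ler_piMl ?rnorm_ge0.
have [Y [YP Yl Y1 YE]] := sqrt_iter_lim kl k1.
have it n x : sqrt_iter (fun x => h * x) n x = sqrt_iter (fun x => h * x) n 1 * x.
  elim: n x => [|n IH] x /=; first by rewrite mul0r.
  by rewrite [in LHS]IH (IH x) (IH (sqrt_iter _ n (1 : A))) -scaleAl mulrDl mulr1 !mulrA.
have its n : star (sqrt_iter (fun x => h * x) n 1) = sqrt_iter (fun x => h * x) n 1.
  elim: n => [|n IH] /=; first by rewrite star0.
  by rewrite mulr1 starZ starD hs it star_mul IH conj_real.
have Yx x : Y x = Y 1 * x.
  apply/subr0_eq/rnorm_eq0/eqP; rewrite eq_le rnorm_ge0 andbT.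
  apply: (@le0_inv_nat _ (2 * rnorm x + 2 * rnorm (1 : A) * rnorm x)) => n.
  rewrite (le_trans (rnorm_triangle _ (sqrt_iter (fun x => h * x) n x) _))// mulrDl lerD//.
    by rewrite rnormBC.
  rewrite it -mulrBl (le_trans (rnormM _ _))// mulrAC ler_wpM2r ?rnorm_ge0//.
have Ys : star (Y 1) = Y 1.
  apply/subr0_eq/rnorm_eq0/eqP; rewrite eq_le rnorm_ge0 andbT.
  apply: (@le0_inv_nat _ (2 * rnorm (1 : A) + 2 * rnorm (1 : A))) => n.
  rewrite (le_trans (rnorm_triangle _ (sqrt_iter (fun x => h * x) n 1) _))// mulrDl lerD//.
  by rewrite -its -starN -starD rnorm_star rnormBC.
exists (1 - Y 1); rewrite starD starN star_one Ys.
have e : Y 1 + Y 1 = h + Y 1 * Y 1 by rewrite YE mulr1 [Y (Y 1)]Yx.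
by rewrite mulrBr mulr1 mulrBl mul1r -addrA -opprD addrA e addrK.
Qed.

Record positive (f : A -> R[i]) : Prop := Positive {
  positive_linear : scalar f ;
  positive_ge0 : forall x, 0 <= f (star x * x) }.

Lemma state_positive (f : A -> R[i]) : state f -> positive f.
Proof. by case. Qed.

End CStar.

Section Positive.
Context (R : realType) (A : cstarType R) (f : A -> R[i]) (fp : positive f).
Implicit Types (a b x y : A) (c : R[i]).

Lemma positiveD x y : f (x + y) = f x + f y.
Proof. exact: (linearD_of (positive_linear fp : linear (f : A -> R[i]^o))). Qed.

Lemma positiveZ c x : f (c *: x) = c * f x.
Proof. exact: (linearZ_of (positive_linear fp : linear (f : A -> R[i]^o))). Qed.

Lemma positive0 : f 0 = 0.
Proof. exact: (linear0_of (positive_linear fp : linear (f : A -> R[i]^o))). Qed.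

Lemma positiveB x y : f (x - y) = f x - f y.
Proof. exact: (linearB_of (positive_linear fp : linear (f : A -> R[i]^o))). Qed.

Lemma positive_herm x y : f (star y * x) = ((f (star x * y))^*)%R.
Proof.
have := ger0_Im (positive_ge0 fp (x + y)).
have := ger0_Im (positive_ge0 fp (x + 'i%C *: y)).
have := ger0_Im (positive_ge0 fp x).
have := ger0_Im (positive_ge0 fp y).
rewrite !starD starZ !mulrDl !mulrDr -!scaleAl -!scaleAr !positiveD !positiveZ.
case: (f (star y * x)) => p q; case: (f (star x * y)) => r s.
case: (f (star x * x)) => t u; case: (f (star y * y)) => v w /= *.
by congr (_ +i* _); lra.
Qed.

Lemma positive_form_linear y : scalar (fun x : A => f (star y * x)).
Proof. by move=> c x x'; rewrite mulrDr -scaleAr positiveD positiveZ. Qed.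

Definition gns_pre : prehilbert R :=
  @PreHilbert R A (fun x y => f (star y * x)) positive_form_linear
    (fun x y => positive_herm x y) (positive_ge0 fp).

Lemma positive_CS x y : modulus (f (star y * x)) ^+ 2 <=
  complex.Re (f (star x * x)) * complex.Re (f (star y * y)).
Proof. exact: (@sform_CS R gns_pre x y). Qed.

(* For r > |a|, the element 1 - r^-2 a^* a has the form x^* x. *)
Lemma positive_mul_le a b :
  complex.Re (f (star (a * b) * (a * b))) <= rnorm a ^+ 2 * complex.Re (f (star b * b)).
Proof.
have le (r : R) : 0 < r -> rnorm a < r -> complex.Re (f (star (a * b) * (a * b))) <=
    r ^+ 2 * complex.Re (f (star b * b)).
  move=> r0 ar; pose h := (r ^- 2)%:C *: (star a * a).
  have hs : star h = h by rewrite starZ conj_real star_mul starK.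
  have h1 : rnorm h <= 1.
    rewrite rnormZ rnorm_starM modulus_real ger0_norm ?invr_ge0 ?sqr_ge0//.
    rewrite mulrC ler_pdivrMr ?exprn_gt0// mul1r.
    by rewrite ler_pXn2r ?nnegrE ?rnorm_ge0 ?ltW.
  have [x xE] := sqrt_one_sub hs h1.
  have hE : star b * (h * b) = (r ^- 2)%:C *: (star (a * b) * (a * b)).
    by rewrite /h -scaleAl -scaleAr star_mul !mulrA.
  have := positive_ge0 fp (x * b).
  rewrite star_mul -mulrA [star x * _]mulrA xE mulrBl mul1r mulrBr positiveB.
  rewrite hE positiveZ lecE => /andP[_] /=; rewrite ReD ReN Re_realM subr_ge0.
  by rewrite mulrC ler_pdivrMr ?exprn_gt0// mulrC.
apply/ler_addgt0Pr => e e0.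
pose q := complex.Re (f (star b * b)).
have q0 : 0 <= q by rewrite -ler0c -ge0_ReE// positive_ge0.
have a0 := rnorm_ge0 a.
(* For d <= 1, replacing |a| by |a| + d raises |a|^2 q by at most d q (2 |a| + 1); the final + 1
   makes K positive so that e / K is meaningful. *)
pose K := q * (2 * rnorm a + 1) + 1.
have K0 : 0 < K by rewrite /K; nra.
pose d := Num.min 1 (e / K).
have d0 : 0 < d by rewrite lt_min ltr01 divr_gt0.
have d1 : d <= 1 by rewrite ge_min lexx.
have dK : d * K <= e by rewrite -ler_pdivlMr// ge_min lexx orbT.
apply: (le_trans (le (rnorm a + d) _ _)); [lra|lra|].
rewrite -/q; clearbody d; move: dK; rewrite /K; clear K K0; clearbody q.
move: (rnorm a) a0 => r r0 dK.
have : q * d * d <= q * d by rewrite ler_piMr// mulr_ge0// ltW.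
nra.
Qed.

Lemma positive_one_ge0 : 0 <= complex.Re (f 1).
Proof. by have := positive_ge0 fp 1; rewrite star_one mulr1 lecE => /andP[]. Qed.

Lemma positive_bound a : modulus (f a) <= complex.Re (f 1) * rnorm a.
Proof.
rewrite -(ler_pXn2r (ltn0Sn 1)) ?nnegrE ?modulus_ge0 ?mulr_ge0 ?positive_one_ge0 ?rnorm_ge0//.
have := positive_CS a 1; rewrite star_one !mul1r => /le_trans; apply.
have := positive_mul_le a 1; rewrite mulr1 star_one mulr1 => h.
by have := positive_one_ge0; nra.
Qed.


Definition gns : hilbertType R := antidual gns_pre.

Lemma qform_gns a : @qform R gns_pre a = complex.Re (f (star a * a)).
Proof. by []. Qed.

(** On functionals a acts by precomposition with b |-> a^* b, the adjoint of left multiplication; on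
    embedded vectors this is b |-> a b. *)
Program Definition gns_op (a : A) (F : antidual gns_pre) : antidual gns_pre :=
  @Antidual R gns_pre (fun b => F (star a * b)) _ _.
Next Obligation.
by move=> a F c x y /=; rewrite mulrDr -scaleAr antidual_linear.
Qed.
Next Obligation.
move=> a F; exists (legendre F * rnorm a ^+ 2).
  by rewrite mulr_ge0 ?legendre_ge0 ?sqr_ge0.
move=> x; rewrite (le_trans (antidual_CS _ _))// -mulrA ler_wpM2l ?legendre_ge0//.
by rewrite !qform_gns (le_trans (positive_mul_le _ _))// rnorm_star.
Qed.

Definition gns_rep (a : A) (F : gns) : gns := gns_op a F.

Definition gns_vec (a : A) : gns := @embed R gns_pre a.

Lemma gns_rep_vec a b : gns_rep a (gns_vec b) = gns_vec (a * b).
Proof. by apply: antidualP => x /=; rewrite star_mul starK mulrA. Qed.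

Lemma gns_rep_bound a F : rnorm (gns_rep a F) <= rnorm a * rnorm F.
Proof.
apply: rnorm_antidual_le; first by rewrite mulr_ge0 ?rnorm_ge0.
move=> b; rewrite (le_trans (@antidual_modulus R gns_pre F (star a * b)))//.
rewrite [rnorm a * _]mulrC -[leRHS]mulrA.
rewrite ler_wpM2l ?rnorm_ge0//.
rewrite !qform_gns -[rnorm a]ger0_norm ?rnorm_ge0// -sqrtr_sqr -sqrtrM ?sqr_ge0//.
by rewrite ler_wsqrtr// (le_trans (positive_mul_le _ _))// rnorm_star.
Qed.

Lemma inner_gns_vec (F : gns) a : inner F (gns_vec a) = F a.
Proof. exact: dot_embed. Qed.

Lemma inner_gns a b : inner (gns_vec a) (gns_vec b) = f (star b * a).
Proof. by rewrite inner_gns_vec. Qed.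

Lemma gns_dense (F : gns) (e : R) : 0 < e -> exists a, rnorm (F - gns_vec a) < e.
Proof. by move=> e0; have [v ve] := @embed_dense R gns_pre F e e0; exists v. Qed.

Lemma gns_representation : representation gns_rep.
Proof.
have gl a : linear (gns_rep a).
  by move=> c F G; apply: antidualP => x.
split => //.
- by move=> a; apply: (linear_bounded_cont (gl a)) => x; exact: gns_rep_bound.
- move=> F c a b; apply: antidualP => x.
  by rewrite /gns_rep /= starD starZ mulrDl -scaleAl antidual_linear conjCK.
- by move=> a b F; apply: antidualP => x /=; rewrite star_mul mulrA.
- move=> a F G; apply/subr0_eq.
  pose D (G : antidual gns_pre) := dot (gns_rep (star a) F) G - dot F (gns_rep a G).
  apply: (@eq0_on_embed _ _ D (2 * rnorm (gns_rep (star a) F) + 2 * rnorm F * rnorm a)) => //.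
  + move=> X Y; rewrite /D !dotDr.
    have -> : gns_rep a (X + Y) = gns_rep a X + gns_rep a Y by exact: (linearD_of (gl a)).
    by rewrite dotDr; ring.
  + move=> X; rewrite (le_trans (modulusD _ _))// modulusN mulrDl lerD//.
      by rewrite -mulrA; exact: dot_le.
    rewrite (le_trans (dot_le _ _))// -!mulrA ler_wpM2l// ler_wpM2l ?rnorm_ge0//.
    exact: gns_rep_bound.
  + move=> v; rewrite /D dot_embed [gns_rep a _]gns_rep_vec dot_embed /=.
    by rewrite starK subrr.
Qed.

End Positive.

(** * Irreducible representations and Schur's lemma *)

Section Representation.
Context (R : realType) (A : cstarType R) (H : hilbertType R) (pi : A -> H -> H).
Hypothesis (rp : representation pi).
Implicit Types (a b : A) (x y : H) (c : R[i]).

Lemma rep_starM a b x y : inner (pi (star b * a) x) y = inner (pi a x) (pi b y).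
Proof. by rewrite (repM rp) (rep_star rp). Qed.

Lemma rep_vec_linear x y : scalar (fun a => inner (pi a x) y).
Proof. by move=> c a b; rewrite (rep_linear rp) innerDl innerZl. Qed.

Lemma rep_vec_positive x : positive (fun a => inner (pi a x) x).
Proof.
split; first exact: rep_vec_linear.
by move=> a; rewrite rep_starM inner_ge0.
Qed.

(** A representation may be degenerate, but [pi 1] is a selfadjoint idempotent: |pi(1) x|^2 = <pi(1)
    x, x> <= |pi(1) x| |x|. *)
Lemma rep_one_le x : complex.Re (inner (pi 1 x) x) <= rnorm x ^+ 2.
Proof.
have e : complex.Re (inner (pi 1 x) x) = rnorm (pi 1 x) ^+ 2.
  by rewrite -[1 in LHS](mulr1 1) -[X in pi (X * _)](star_one A) rep_starM innerE.
rewrite e; have := le_trans (ler_norm _) (le_trans (Re_le_modulus _) (inner_CS (pi 1 x) x)).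
rewrite e; have := rnorm_ge0 x; have := rnorm_ge0 (pi 1 x).
move: (rnorm _) (rnorm x) => p q p0 q0 h.
have [->|pn] := eqVneq p 0; first by rewrite expr0n sqr_ge0.
have p1 : 0 < p by rewrite lt_neqAle eq_sym pn.
have : p <= q by rewrite -(ler_pM2l p1) -expr2.
by move=> pq; rewrite ler_pXn2r ?nnegrE.
Qed.

(** The functional of the vector x is positive, so the GNS estimate [positive_mul_le] with b = 1
    applies to it. *)
Lemma rep_bound a x : rnorm (pi a x) <= rnorm a * rnorm x.
Proof.
rewrite -(ler_pXn2r (ltn0Sn 1)) ?nnegrE ?mulr_ge0 ?rnorm_ge0//.
have := positive_mul_le (rep_vec_positive x) a 1.
rewrite mulr1 star_one mulr1 rep_starM innerE /= => /le_trans; apply.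
by rewrite exprMn ler_wpM2l ?sqr_ge0// rep_one_le.
Qed.

(** The vectors killed by A form a closed invariant subspace, which is not everything because pi is
    nonzero. *)
Lemma annihilated_trivial : nonzero_irreducible pi ->
  forall x, (forall a, pi a x = 0) -> x = 0.
Proof.
case=> -[a [x /eqP ax]] irr y ya.
have [||N0|NT] := irr [set z | forall b, pi b z = 0].
- split => /=.
  + by move=> b; exact: linear0_of (rep_op_linear rp b).
  + by move=> c u v hu hv b; rewrite (rep_op_linear rp) hu hv scaler0 addr0.
  + have -> : [set z | forall b, pi b z = 0] = \bigcap_(b in setT) [set z | pi b z = 0].
      by apply/seteqP; split=> [z h b _|z h b] /=; [exact: h|exact: h].
    apply: closed_bigI => b _.
    by apply: (kernel_closed (rep_op_linear rp b)) => z; exact: rep_bound.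
- by move=> b z hz d; rewrite -(repM rp) hz.
- by have : [set z | forall b, pi b z = 0] y by []; rewrite N0.
- have : [set z | forall b, pi b z = 0] x by rewrite NT.
  by move=> /(_ a) /ax.
Qed.

Lemma irreducible_unital : nonzero_irreducible pi -> forall x, pi 1 x = x.
Proof.
move=> irr x; apply/subr0_eq/(annihilated_trivial irr) => a.
by rewrite (linearB_of (rep_op_linear rp a)) -(repM rp) mulr1 subrr.
Qed.

Lemma irreducible_cyclic : nonzero_irreducible pi -> forall x, x != 0 ->
  forall y (e : R), 0 < e -> exists a, rnorm (y - pi a x) < e.
Proof.
move=> irr x x0 y e e0.
pose S := closure [set pi a x | a in setT].
have cS : closed_subspace S.
  split; last exact: closed_closure.
    by apply: subset_closure; exists 0 => //; exact: (linear0_of (rep_linear rp x)).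
  move=> c u v /closureP Su /closureP Sv; apply/closureP => d d0.
  have d2 : 0 < d / 2 by rewrite divr_gt0.
  have m0 : 0 < modulus c + 1 by rewrite ltr_wpDl ?modulus_ge0.
  have [_ [a _ <-] ua] := Su _ (divr_gt0 d2 m0).
  have [_ [b _ <-] vb] := Sv _ d2.
  exists (pi (c *: a + b) x); first by exists (c *: a + b).
  rewrite (rep_linear rp) opprD addrACA -scalerBr (le_lt_trans (rnormD _ _))//.
  rewrite rnormZ; have h : modulus c * rnorm (u - pi a x) <= d / 2.
    move: ua; rewrite ltr_pdivlMr// => ua; apply/ltW; apply: le_lt_trans ua.
    by rewrite mulrC ler_wpM2l ?rnorm_ge0// lerDl.
  by move: h vb; move: (modulus c * _) (rnorm (v - _)) => p q *; lra.
have iS a z : S z -> S (pi a z).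
  move=> /closureP Sz; apply/closureP => d d0.
  have m0 : 0 < rnorm a + 1 by rewrite ltr_wpDl ?rnorm_ge0.
  have [_ [b _ <-] ub] := Sz _ (divr_gt0 d0 m0).
  exists (pi (a * b) x); first by exists (a * b).
  rewrite (repM rp) -(linearB_of (rep_op_linear rp a)) (le_lt_trans (rep_bound _ _))//.
  move: ub; rewrite ltr_pdivlMr// => ub; apply: le_lt_trans ub.
  by rewrite mulrC ler_wpM2l ?rnorm_ge0// lerDl.
have [S0|ST] := irr.2 S cS iS.
  have Sx a : pi a x = 0.
    have : S (pi a x) by apply: subset_closure; exists a.
    by rewrite S0.
  by move: x0; rewrite (annihilated_trivial irr Sx) eqxx.
have : S y by rewrite ST.
by move=> /closureP/(_ e e0)[_ [a _ <-] ya]; exists a.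
Qed.

End Representation.

Section Schur.
Context (R : realType) (A : cstarType R) (H : hilbertType R) (pi : A -> H -> H).
Hypothesis (rp : representation pi) (irr : nonzero_irreducible pi).

(* With |h| the square root of h^2, the subspace ker (|h| - h) is invariant and
   contains the range of |h| + h. *)
Lemma commutant_sign (h : H -> H) : linear h ->
  (forall x, rnorm (h x) <= rnorm x) ->
  (forall x y, inner (h x) y = inner x (h y)) ->
  (forall a x, h (pi a x) = pi a (h x)) ->
  (forall x, 0 <= complex.Re (inner (h x) x)) \/
  (forall x, complex.Re (inner (h x) x) <= 0).
Proof.
move=> hl h1 hs hpi.
(* With k = 1 - h^2, the root 1 - Y of 1 - k is |h|. It is positive because Y is a contraction, and
   it commutes with h and with pi. *)
pose k x := x - h (h x).
have kl : linear k.
  by move=> c x y; rewrite /k !hl scalerBr opprD addrACA.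
have k1 x : rnorm (k x) <= rnorm x.
  rewrite -(ler_pXn2r (ltn0Sn 1)) ?nnegrE ?rnorm_ge0// rnormB_sqr.
  rewrite innerC hs -innerC innerE /=.
  have : rnorm (h (h x)) ^+ 2 <= rnorm (h x) ^+ 2.
    by rewrite ler_pXn2r ?nnegrE ?rnorm_ge0.
  by have := sqr_ge0 (rnorm (h x)); lra.
have [Y [Yl Y1 YE Yc]] := sqrt_exists kl k1.
have Yh x : Y (h x) = h (Y x).
  apply: (Yc h 1 hl) => [z|z]; first by rewrite mul1r.
  by rewrite /k -(linearB_of hl).
have Ypi a x : Y (pi a x) = pi a (Y x).
  apply: (Yc (pi a) (rnorm a) (rep_op_linear rp a)) => [z|z]; first exact: rep_bound.
  by rewrite /k !hpi (linearB_of (rep_op_linear rp a)).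
pose g x := x - Y x.
have gl : linear g by move=> c x y; rewrite /g Yl scalerBr opprD addrACA.
have gpos x : 0 <= complex.Re (inner (g x) x).
  rewrite /g innerDl innerNl ReD ReN innerE /= subr_ge0.
  have := le_trans (ler_norm _) (le_trans (Re_le_modulus _) (inner_CS (Y x) x)).
  by move=> /le_trans; apply; rewrite expr2 ler_wpM2r ?rnorm_ge0.
have gg x : g (g x) = h (h x).
  have := YE x; rewrite /g (linearB_of Yl) => e.
  by rewrite -addrA -opprD addrA e addrK /k subKr.
have gh x : g (h x) = h (g x) by rewrite /g (linearB_of hl) Yh.
pose f x := g x - h x.
have fl : linear f.
  by move=> c x y; rewrite /f gl hl [c *: (g x - h x)]scalerBr opprD addrACA.
have f3 x : rnorm (f x) <= 3 * rnorm x.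
  have := rnormD (g x) (- h x); have := rnormD x (- Y x); rewrite !rnormN.
  by have := Y1 x; have := h1 x; rewrite -/(g x) -/(f x) => *; lra.
(* (|h| - h)(|h| + h) = 0, so a trivial kernel of |h| - h means h = - |h|, and a full one means h =
   |h|. *)
have [||S0|ST] := irr.2 [set x | f x = 0].
- exact: closed_subspace_kernel fl f3.
- move=> a x /= fx; rewrite /f /g Ypi hpi -!(linearB_of (rep_op_linear rp a)).
  by rewrite -/(g x) -/(f x) fx (linear0_of (rep_op_linear rp a)).
- right=> x.
  have : [set x | f x = 0] (g x + h x).
    by rewrite /= /f (linearD_of gl) (linearD_of hl) gg gh [X in X - _]addrC subrr.
  rewrite S0 /= addrC => /eqP; rewrite addr_eq0 => /eqP ->.
  by rewrite innerNl ReN oppr_le0.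
- left=> x; have : [set x | f x = 0] x by rewrite ST.
  by move=> /= /subr0_eq <-.
Qed.

(** For each real l the operator h - l has a sign. Hence the supremum of the l below h is also above
    h, the quadratic form of h minus that scalar vanishes, and a selfadjoint operator with zero form
    is zero. *)
Lemma commutant_scalar (h : H -> H) (K : R) : linear h ->
  (forall x, rnorm (h x) <= K * rnorm x) ->
  (forall x y, inner (h x) y = inner x (h y)) ->
  (forall a x, h (pi a x) = pi a (h x)) ->
  exists r : R, forall x, h x = r%:C *: x.
Proof.
move=> hl hK hs hpi.
pose Q x := complex.Re (inner (h x) x).
have QK x : `|Q x| <= `|K| * rnorm x ^+ 2.
  rewrite (le_trans (Re_le_modulus _))// (le_trans (inner_CS _ _))//.
  rewrite expr2 mulrA ler_wpM2r ?rnorm_ge0// (le_trans (hK _))//.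
  by rewrite ler_wpM2r ?rnorm_ge0// ler_norm.
have dich (l : R) : (forall x, l * rnorm x ^+ 2 <= Q x) \/
                    (forall x, Q x <= l * rnorm x ^+ 2).
  (* Dividing h - l by M makes it a contraction, as [commutant_sign] requires. *)
  pose M : R := `|K| + `|l| + 1.
  have M0 : 0 < M by rewrite ltr_wpDl// addr_ge0.
  pose h' x := (M^-1)%:C *: (h x - l%:C *: x).
  have Qh' x : complex.Re (inner (h' x) x) = M^-1 * (Q x - l * rnorm x ^+ 2).
    by rewrite innerZl innerDl innerNl innerZl innerE Re_realM ReD ReN Re_realM.
  have [||||pos|neg] := @commutant_sign h'.
  - move=> c x y; rewrite /h' hl !scalerBr !scalerDr !scalerA opprD addrACA.
    have -> : (M^-1)%:C * c = c * (M^-1)%:C by rewrite mulrC.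
    by have -> : (M^-1)%:C * l%:C * c = c * (M^-1)%:C * l%:C by rewrite mulrC mulrA.
  - move=> x; have Mi : 0 <= M^-1 by rewrite invr_ge0 ltW.
    rewrite rnormZ modulus_real ger0_norm//.
    rewrite mulrC ler_pdivrMr// (le_trans (rnormD _ _))// rnormN rnormZ modulus_real.
    have := rnorm_ge0 x; have := hK x; have : K * rnorm x <= `|K| * rnorm x.
      by rewrite ler_wpM2r ?rnorm_ge0// ler_norm.
    by rewrite /M; move: (rnorm x) => z *; nra.
  - move=> x y; rewrite /h' innerZl innerZr conj_real innerDl innerDr innerNl innerNr.
    by rewrite hs innerZl innerZr conj_real.
  - move=> a x; have pl := rep_op_linear rp a.
    by rewrite /h' hpi -(linearZ_of pl) -(linearB_of pl) -(linearZ_of pl).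
  - left=> x; have := pos x; rewrite Qh' pmulr_rge0 ?invr_gt0// subr_ge0//.
  - right=> x; have := neg x; rewrite Qh' pmulr_rle0 ?invr_gt0// subr_le0//.
pose D := [set l : R | forall x, l * rnorm x ^+ 2 <= Q x].
have [a [z az]] := irr.1.
have z0 : 0 < rnorm z.
  rewrite lt_neqAle rnorm_ge0 andbT eq_sym; apply: contra_neq az => /rnorm_eq0 ->.
  exact: linear0_of (rep_op_linear rp a).
have supD : has_sup D.
  split.
    exists (- `|K|) => x; have := QK x; rewrite ler_norml => /andP[+ _].
    by rewrite mulNr.
  exists `|K| => l /(_ z) lz.
  rewrite -(ler_pM2r (exprn_gt0 2 z0)) (le_trans lz)// (le_trans (ler_norm _))//.
have ge x : sup D * rnorm x ^+ 2 <= Q x.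
  have [->|x0] := eqVneq x 0.
    by rewrite rnorm0 expr0n mulr0 /Q (linear0_of hl) inner0l.
  have x1 : 0 < rnorm x.
    by rewrite lt_neqAle rnorm_ge0 andbT eq_sym; apply: contra_neq x0 => /rnorm_eq0.
  rewrite -ler_pdivlMr ?exprn_gt0//; apply: ge_sup; first by case: supD.
  by move=> l /(_ x); rewrite ler_pdivlMr ?exprn_gt0.
have le x : Q x <= sup D * rnorm x ^+ 2.
  apply/ler_addgt0Pr => e e0.
  pose d := e / (rnorm x ^+ 2 + 1).
  have x1 : 0 < rnorm x ^+ 2 + 1 by rewrite ltr_wpDl ?sqr_ge0.
  have d0 : 0 < d by rewrite divr_gt0.
  have [inD|le] := dich (sup D + d).
    have : sup D + d <= sup D by apply: sup_upper_bound.
    by rewrite -subr_ge0 opprD addrA subrr add0r oppr_ge0 leNgt d0.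
  rewrite (le_trans (le x))// mulrDl lerD2l /d mulrAC ler_pdivrMr// ler_pM2l//.
  by rewrite lerDl.
exists (sup D) => x; apply/subr0_eq.
pose g y := h y - (sup D)%:C *: y.
have gl : linear g.
  by move=> c u v; rewrite /g hl scalerBr scalerDr !scalerA [c * _]mulrC opprD addrACA.
have gQ y : complex.Re (inner (g y) y) = 0.
  rewrite innerDl innerNl innerZl innerE ReD ReN Re_realM /=; apply/eqP.
  by rewrite subr_eq0 eq_le le ge.
have gs u v : inner (g u) v = inner u (g v).
  by rewrite innerDl innerDr innerNl innerNr innerZl innerZr conj_real hs.
rewrite -/(g x); clearbody g; apply: inner_eq0.
(* The form at x + g x equals 2 |g x|^2, since the two diagonal terms vanish and the cross terms
   agree by selfadjointness. *)
have := gQ (x + g x); rewrite (linearD_of gl) innerDl !innerDr !ReD !gQ.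
by rewrite add0r addr0 [inner (g (g x)) _]gs innerE /= => h0; congr (_%:C); lra.
Qed.

End Schur.

(** * Pure states *)

Lemma linear_eq0_on_embed (R : realType) (P : prehilbert R) (W : normedModType R[i])
  (f : antidual P -> W) (K : R) : linear f ->
  (forall F, rnorm (f F) <= K * rnorm F) -> (forall v, f (embed v) = 0) ->
  forall F, f F = 0.
Proof.
move=> fl fK f0 F; have : closed [set F | f F = 0] by exact: kernel_closed fl fK.
move/closure_id => cl; suff : [set F | f F = 0] F by [].
rewrite cl; apply/closureP => e e0; have [v ve] := embed_dense F e0.
by exists (embed v) => //=; exact: f0.
Qed.

(* The Riesz representation is built into [antidual]: T F is the functional
   y |-> <F, S y>, where S y is the functional x |-> (s x y)^*. *)
Lemma sesq_operator (R : realType) (P : prehilbert R) (s : P -> P -> R[i]) :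
  (forall y, scalar (s^~ y)) ->
  (forall c x y z, s x (c *: y + z) = (c^*)%R * s x y + s x z) ->
  (forall x y, modulus (s x y) ^+ 2 <= qform x * qform y) ->
  exists T : antidual P -> antidual P, [/\ linear T,
    forall F, rnorm (T F) <= rnorm F & forall x y, T (embed x) y = s x y].
Proof.
move=> sl sr sb.
have Sl y : forall c x x', ((s (c *: x + x') y)^*)%R =
    (c^*)%R * ((s x y)^*)%R + ((s x' y)^*)%R.
  by move=> c x x'; rewrite sl rmorphD rmorphM.
have Sb y : exists2 M, 0 <= M & forall x, modulus ((s x y)^*)%R ^+ 2 <= M * qform x.
  exists (qform y); first exact: qform_ge0.
  by move=> x; rewrite modulus_conj mulrC.
pose S y : antidual P := Antidual (Sl y) (Sb y).
have SN y : rnorm (S y) <= Num.sqrt (qform y).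
  apply: rnorm_antidual_le; first exact: sqrtr_ge0.
  move=> x; rewrite -sqrtrM ?qform_ge0// -[leLHS]ger0_norm ?modulus_ge0//.
  by rewrite -sqrtr_sqr ler_wsqrtr//= modulus_conj mulrC.
have SP c y z : S (c *: y + z) = c *: S y + S z.
  by apply: antidualP => x;
    rewrite antidual_addE antidual_scaleE /= sr rmorphD rmorphM /= conjCK.
have Tl F c y z : inner F (S (c *: y + z)) = (c^*)%R * inner F (S y) + inner F (S z).
  by rewrite SP innerDr innerZr.
have Tm F y : modulus (inner F (S y)) <= rnorm F * Num.sqrt (qform y).
  by rewrite (le_trans (inner_CS _ _))// ler_wpM2l ?rnorm_ge0//; exact: SN.
have Tb F : exists2 M, 0 <= M & forall y, modulus (inner F (S y)) ^+ 2 <= M * qform y.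
  exists (rnorm F ^+ 2); first exact: sqr_ge0.
  move=> y; rewrite -[qform y]sqr_sqrtr ?qform_ge0// -exprMn.
  by rewrite ler_pXn2r ?nnegrE ?modulus_ge0 ?mulr_ge0 ?sqrtr_ge0 ?rnorm_ge0.
exists (fun F => Antidual (Tl F) (Tb F)); split.
- by move=> c F G; apply: antidualP => y;
  rewrite antidual_addE antidual_scaleE /= innerDl innerZl.
- by move=> F; apply: rnorm_antidual_le; [exact: rnorm_ge0|exact: Tm].
- move=> x y /=; rewrite innerC;
  have -> : inner (S y) (embed x) = S y x by exact: dot_embed.
  by rewrite /= conjCK.
Qed.

Section Purity.
Context (R : realType) (A : cstarType R).
Implicit Types (phi psi tau : A -> R[i]).

(** With t = tau 1, phi is the convex combination of tau / t and (phi - tau) / (1 - t), so purity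
    gives tau = t phi. When t is 0 or 1, one of tau and phi - tau is a positive functional vanishing
    at 1, hence zero. *)
Lemma pure_dominated phi tau : pure_state phi -> positive tau ->
  (forall a, complex.Re (tau (star a * a)) <= complex.Re (phi (star a * a))) ->
  forall a, tau a = tau 1 * phi a.
Proof.
move=> [ps pure] tp dom a.
have pp := state_positive ps.
have t0 : 0 <= tau 1 by have := positive_ge0 tp 1; rewrite star_one mulr1.
have tE := ge0_ReE t0; set t := complex.Re (tau 1) in tE.
have t0' : 0 <= t by rewrite -ler0c -tE.
have dp : positive (fun a => phi a - tau a).
  split.
    move=> c x y; rewrite (positive_linear pp) (positive_linear tp).
    by rewrite mulrBr opprD addrACA.
  move=> x; rewrite (ge0_ReE (positive_ge0 pp x)) (ge0_ReE (positive_ge0 tp x)).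
  by rewrite -rmorphB /= ler0c subr_ge0.
have t1 : t <= 1.
  by have := dom 1; rewrite star_one mulr1 (state1 ps).
have null f : positive f -> f 1 = 0 -> f a = 0.
  move=> fp f1; apply: modulus_eq0; apply/eqP; rewrite eq_le modulus_ge0 andbT.
  by rewrite (le_trans (positive_bound fp a))// f1 mul0r.
have [t_eq0|tn0] := eqVneq t 0.
  by rewrite tE t_eq0 mul0r null// tE t_eq0.
have [t_eq1|tn1] := eqVneq t 1.
  rewrite tE t_eq1 mul1r; apply/esym/subr0_eq/(null _ dp).
  by rewrite (state1 ps) tE t_eq1 subrr.
have tgt0 : 0 < t by rewrite lt_neqAle eq_sym tn0.
have tlt1 : 0 < 1 - t by rewrite subr_gt0 lt_neqAle tn1.
have scale (r : R) (f : A -> R[i]) : positive f -> 0 < r -> f 1 = r%:C -> state (fun a => (r^-1)%:C * f a).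
  move=> fp r0 f1; split.
  - by move=> c x y; rewrite (positive_linear fp) mulrDr mulrCA.
  - move=> x; apply: mulr_ge0; first by rewrite ler0c invr_ge0 ltW.
    exact: positive_ge0.
  - by rewrite f1 -rmorphM mulVf ?gt_eqF.
have d1 : phi 1 - tau 1 = (1 - t)%:C by rewrite (state1 ps) tE rmorphB.
have [|x|e _] := pure _ _ t (scale _ _ tp tgt0 tE) (scale _ _ dp tlt1 d1).
- by rewrite tgt0 -subr_gt0.
- rewrite !mulrA -!rmorphM !mulfV ?gt_eqF// !mul1r; ring.
- by rewrite -e tE mulrA -rmorphM mulfV ?gt_eqF// mul1r.
Qed.

Lemma gns_vec1_norm phi (pp : positive phi) : phi 1 = 1 -> rnorm (gns_vec pp 1) = 1.
Proof.
move=> p1; apply/eqP; rewrite -(@eqrXn2 _ 2) ?rnorm_ge0// expr1n; apply/eqP/complexI.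
by rewrite -innerE inner_gns star_one mulr1 p1.
Qed.

Lemma gns_closed_total phi (pp : positive phi) (S : set (gns pp)) : closed S ->
  (forall a, S (gns_vec pp a)) -> S = setT.
Proof.
move=> /closure_id cS Sv; apply/seteqP; split=> // F _; rewrite cS.
apply/closureP => e e0; have [a ae] := gns_dense F e0.
by exists (gns_vec pp a).
Qed.

(* The component of the cyclic vector in an invariant subspace gives a positive
   functional dominated by phi. *)
Lemma pure_gns_irreducible phi (pp : positive phi) : pure_state phi ->
  nonzero_irreducible (@gns_rep _ _ _ pp).
Proof.
move=> pure; have ps := pure.1.
have rp := gns_representation pp; pose xi := gns_vec pp 1.
have xi1 : rnorm xi = 1 by apply: gns_vec1_norm; exact: state1 ps.
have piv a : gns_rep a xi = gns_vec pp a by rewrite gns_rep_vec mulr1.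
split.
  exists 1, xi; rewrite piv -/xi; apply/eqP => x0.
  by move: xi1; rewrite x0 rnorm0 => /esym/eqP; rewrite oner_eq0.
move=> S cS iS.
have [s Ss orth] := projection xi cS.
have orthP a F : S F -> inner (gns_rep a (xi - s)) F = 0.
  by move=> SF; rewrite -[a]starK (rep_star rp) orth//; exact: iS.
pose tau a := inner (gns_rep a s) s.
have tp : positive tau by exact: (rep_vec_positive rp).
have dec a : gns_vec pp a = gns_rep a s + gns_rep a (xi - s).
  by rewrite -(linearD_of (rep_op_linear rp a)) addrC subrK piv.
have tE := pure_dominated pure tp.
have {}tE a : tau a = tau 1 * phi a.
  apply: tE => b; rewrite /tau rep_starM// innerE /=.
  have -> : complex.Re (phi (star b * b)) = rnorm (gns_vec pp b) ^+ 2.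
    by rewrite -(inner_gns pp) innerE.
  rewrite dec rnormD_sqr innerC orthP ?rmorph0/= ?mulr0 ?addr0 ?lerDl ?sqr_ge0//.
  exact: iS.
(* The projection s of the cyclic vector is thus a multiple of it: either s = 0 and S is orthogonal
   to all pi(a) xi, or xi lies in S. *)
have sE : s = (tau 1)^*%R *: xi.
  apply: antidualP => a; rewrite antidual_scaleE -inner_gns_vec innerC.
  rewrite [in LHS]dec innerDl orthP// addr0 -/(tau a) tE rmorphM /=; congr (_ * _).
  by rewrite (positive_herm pp) star_one mul1r.
have [t0|tn0] := eqVneq (tau 1) 0.
  left; apply/seteqP; split=> [F SF|F ->] /=; last exact: (closed_subspace0 cS).
  apply: antidualP => a; rewrite -inner_gns_vec -piv -(rep_star rp) innerC.
  have <- : xi - s = xi by rewrite sE t0 rmorph0 scale0r subr0.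
  by rewrite orth ?rmorph0//; exact: iS.
right; apply: (gns_closed_total (closed_subspace_closed cS)) => a.
rewrite -piv; apply: iS.
have -> : xi = ((tau 1)^*%R)^-1 *: s + 0.
  by rewrite addr0 sE scalerA mulVf ?scale1r// conjC_eq0.
by apply: (Defs.closed_subspaceP cS) => //; exact: (closed_subspace0 cS).
Qed.

Lemma irreducible_transfer (H K : hilbertType R) (pi : A -> H -> H)
  (rho : A -> K -> K) (W : H -> K) : nonzero_irreducible pi -> linear W ->
  (forall x, rnorm (W x) = rnorm x) -> (forall y, exists x, W x = y) ->
  (forall a x, W (pi a x) = rho a (W x)) -> nonzero_irreducible rho.
Proof.
move=> [[a [x ax]] irr] Wl Wn Ws WE.
have W0 z : W z = 0 -> z = 0.
  by move=> z0; apply: rnorm_eq0; rewrite -Wn z0 rnorm0.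
split.
  by exists a, (W x); rewrite -WE; apply: contra_neq ax => /W0.
move=> S [S0 SP cS] iS.
have [||E|E] := irr (W @^-1` S).
- split; first by rewrite /= (linear0_of Wl).
    by move=> c u v /= Su Sv; rewrite Wl; exact: SP.
  move=> u /closureP uS /=; rewrite (closure_id S).1//; apply/closureP => e e0.
  by have [v Sv uv] := uS e e0; exists (W v) => //; rewrite -(linearB_of Wl) Wn.
- by move=> b u /= Su; rewrite WE; exact: iS.
- left; apply/seteqP; split=> [y Sy|y -> //]; have [u uy] := Ws y.
  have : (W @^-1` S) u by rewrite /= uy.
  by rewrite E /= -uy => ->; exact: linear0_of.
- right; apply/seteqP; split=> // y _; have [u <-] := Ws y.
  by have : (W @^-1` S) u by rewrite E.
Qed.

(** * Vector states of irreducible representations *)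

Section VectorState.
Context (H : hilbertType R) (pi : A -> H -> H) (rp : representation pi)
  (irr : nonzero_irreducible pi) (xi : H) (xi1 : rnorm xi = 1).

Let phi a := inner (pi a xi) xi.
Let pp : positive phi := rep_vec_positive rp xi.

Lemma vector_state : state phi.
Proof.
case: pp => pl p0; split=> //.
by rewrite /phi irreducible_unital// innerE xi1 expr1n.
Qed.

(** Operators are built from forms on the GNS space, so irreducibility is needed there. W x is the
    functional b |-> <x, pi(b) xi>; it sends pi(a) xi to the vector of a, is isometric because xi is
    cyclic, and intertwines the two representations. *)
Lemma vector_gns_irreducible : nonzero_irreducible (@gns_rep _ _ _ pp).
Proof.
have Wl x : forall c b b', inner x (pi (c *: b + b') xi) =
    (c^*)%R * inner x (pi b xi) + inner x (pi b' xi).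
  by move=> c b b'; rewrite (rep_linear rp) innerDr innerZr.
have q b : @qform R (gns_pre pp) b = rnorm (pi b xi) ^+ 2.
  by rewrite qform_gns /phi rep_starM// innerE.
have Wb x : exists2 M, 0 <= M & forall b,
    modulus (inner x (pi b xi)) ^+ 2 <= M * @qform R (gns_pre pp) b.
  exists (rnorm x ^+ 2); first exact: sqr_ge0.
  move=> b; rewrite q -exprMn.
  by rewrite ler_pXn2r ?nnegrE ?modulus_ge0 ?mulr_ge0 ?rnorm_ge0 ?inner_CS.
pose W x : gns pp := @Antidual R (gns_pre pp) _ (Wl x) (Wb x).
have Wlin : linear W.
  by move=> c x y; apply: antidualP => b;
    rewrite antidual_addE antidual_scaleE /= innerDl innerZl.
have Wv a : W (pi a xi) = gns_vec pp a.
  by apply: antidualP => b /=; rewrite -rep_starM.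
have Wle x : rnorm (W x) <= rnorm x.
  apply: rnorm_antidual_le; first exact: rnorm_ge0.
  by move=> b; rewrite q sqrtr_sqr ger0_norm ?rnorm_ge0//; exact: inner_CS.
have xi0 : xi != 0.
  by apply/eqP => x0; move: xi1; rewrite x0 rnorm0 => /esym/eqP; rewrite oner_eq0.
have Wn x : rnorm (W x) = rnorm x.
  apply/eqP; rewrite eq_le Wle /= -subr_le0; apply: (@le0_inv_nat _ 2) => n.
  have n0 : 0 < n.+1%:R^-1 :> R by rewrite invr_gt0.
  have [a xa] := irreducible_cyclic rp irr xi0 x n0.
  have e : rnorm (W (pi a xi)) = rnorm (pi a xi).
    by rewrite Wv /gns_vec rnorm_embed q sqrtr_sqr ger0_norm ?rnorm_ge0.
  have := rnorm_sub_le x (pi a xi); have := rnorm_sub_le (W (pi a xi)) (W x).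
  have := Wle (pi a xi - x);
    rewrite (linearB_of Wlin) rnormBC [rnorm (pi a xi - x)]rnormBC.
  move: xa; rewrite e.
  by move: (n.+1%:R^-1 : R) => z *; lra.
apply: (irreducible_transfer irr Wlin Wn).
- move=> y; have : range W = setT.
    apply: gns_closed_total; first exact: isometry_range_closed.
    by move=> a; exists (pi a xi).
  move=> rW; have [x _ xy] : range W y by rewrite rW.
  by exists x.
- by move=> a x; apply: antidualP => b /=; rewrite (repM rp) -[RHS](rep_star rp) starK.
Qed.

(* A summand t psi1 of phi defines a positive operator in the commutant of the
   GNS representation, hence a scalar. *)
Lemma vector_state_pure : pure_state phi.
Proof.
split; first exact: vector_state.
suff H1 psi1 psi2 (t : R) : state psi1 -> state psi2 -> 0 < t < 1 ->
    (forall x, phi x = t%:C * psi1 x + (1 - t)%:C * psi2 x) -> psi1 = phi.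
  move=> psi1 psi2 t s1 s2 t01 E; split; first exact: (H1 psi1 psi2 t).
  apply: (H1 psi2 psi1 (1 - t)) => //; first by move: t01 => /andP[]; lra.
  by move=> x; rewrite E [RHS]addrC subKr.
move=> s1 s2 /andP[t0 t1] E.
have p1 := state_positive s1; have p2 := state_positive s2.
(* Since t psi1 is dominated by phi, its form is bounded by the GNS form of phi, which is the
   hypothesis of [sesq_operator]. *)
pose s (a b : gns_pre pp) : R[i] := t%:C * psi1 (star b * a).
have dom a : t * complex.Re (psi1 (star a * a)) <= complex.Re (phi (star a * a)).
  rewrite E ReD !Re_realM lerDl; apply: mulr_ge0; first by rewrite subr_ge0 ltW.
  by have := positive_ge0 p2 a; rewrite lecE => /andP[].
have [||| T [Tl T1 TE]] := @sesq_operator R (gns_pre pp) s.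
- move=> y c a b; rewrite /s mulrDr -scaleAr (positive_linear p1) mulrDr mulrCA//.
- move=> c a b d; rewrite /s starD starZ mulrDl -scaleAl (positive_linear p1).
  by rewrite mulrDr mulrCA.
- move=> a b; have t0' := ltW t0.
  rewrite /s modulusM modulus_real ger0_norm// exprMn !qform_gns.
  have := positive_CS p1 a b; have := dom a; have := dom b.
  have h (c : A) : 0 <= complex.Re (psi1 (star c * c)).
    by have := positive_ge0 p1 c; rewrite lecE => /andP[].
  have := h a; have := h b; move: (modulus _ ^+ 2) => m hb ha db da hm.
  have := ler_pM (mulr_ge0 (ltW t0) ha) (mulr_ge0 (ltW t0) hb) da db.
  move=> /(le_trans _); apply; rewrite mulrACA -expr2.
  by rewrite ler_wpM2l ?sqr_ge0.
pose rep := @gns_rep _ _ _ pp; have rr : representation rep by exact: gns_representation.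
have Tlin0 : linear (T : gns pp -> gns pp) by [].
have Tv (a b : A) : inner (T (gns_vec pp a) : gns pp) (gns_vec pp b) = s a b.
  by rewrite inner_gns_vec TE.
have Tcomm a F : T (rep a F) = rep a (T F).
  apply/subr0_eq; pose f (F : antidual (gns_pre pp)) : gns pp := T (rep a F) - rep a (T F).
  have fl : linear f.
    move=> c u v; rewrite /f (rep_op_linear rr) !Tl (rep_op_linear rr).
    by rewrite scalerBr opprD addrACA.
  apply: (linear_eq0_on_embed fl (K := 2 * rnorm a)).
    move=> G; have := rnormD (T (rep a G) : gns pp) (- rep a (T G)); rewrite rnormN.
    have := T1 (rep a G); have := rep_bound rr a (T G); have := rep_bound rr a G.
    have : rnorm a * rnorm (T G) <= rnorm a * rnorm G by rewrite ler_wpM2l ?rnorm_ge0.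
    rewrite /f -mulrA; lra.
  move=> v; apply/eqP; rewrite subr_eq0; apply/eqP; apply: antidualP => b.
  have -> : rep a (embed v) = @embed R (gns_pre pp) (a * (v : A)) by exact: gns_rep_vec.
  rewrite TE /= TE /s star_mul starK mulrA//.
(* Selfadjointness is extended from embedded vectors one variable at a time, the second one
   first. *)
have Tself F G : inner (T F : gns pp) G = inner (F : gns pp) (T G).
  have dd (f : antidual (gns_pre pp) -> R[i]) := @eq0_on_embed R (gns_pre pp) f.
  have sC (a b : A) : s a b = ((s b a)^*)%R.
    by rewrite /s rmorphM /= conj_real (positive_herm p1).
  have e1 (a : A) (G' : gns pp) : inner (T (gns_vec pp a) : gns pp) G' = inner (gns_vec pp a) (T G').
    apply/subr0_eq; pose f (G' : antidual (gns_pre pp)) :=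
      inner (T (gns_vec pp a) : gns pp) G' - inner (gns_vec pp a) (T G' : gns pp).
    apply: (dd f (rnorm (T (gns_vec pp a) : gns pp) + rnorm (gns_vec pp a))).
    - by move=> X Y; rewrite /f (linearD_of Tl) !innerDr; ring.
    - move=> X; rewrite (le_trans (modulusD _ _))// modulusN mulrDl lerD//.
        exact: inner_CS.
      by rewrite (le_trans (inner_CS _ _))// ler_wpM2l ?rnorm_ge0//; exact: T1.
    - move=> v; rewrite /f -/(gns_vec pp v) Tv innerC Tv -sC subrr//.
  apply/subr0_eq; pose f (F : antidual (gns_pre pp)) :=
      ((inner (T F : gns pp) G - inner (F : gns pp) (T G))^*)%R.
  suff : f F = 0 by rewrite /f => /eqP; rewrite conjC_eq0 => /eqP.
  apply: (dd f (rnorm G + rnorm (T G : gns pp))).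
  - by move=> X Y; rewrite /f (linearD_of Tl) !innerDl -rmorphD /=; congr (_^*)%R; ring.
  - move=> X; rewrite modulus_conj (le_trans (modulusD _ _))// modulusN mulrDl lerD//.
      rewrite (le_trans (inner_CS _ _))// mulrC ler_wpM2l ?rnorm_ge0//; exact: T1.
    by rewrite (le_trans (inner_CS _ _))// mulrC.
  - by move=> v; rewrite /f e1 subrr rmorph0.
have [|r rE] := @commutant_scalar _ _ _ rep rr vector_gns_irreducible T 1 Tlin0 _ Tself Tcomm.
  by move=> F; rewrite mul1r; exact: T1.
(* Matrix coefficient of T = r at the cyclic vector; at a = 1 it gives r = t. *)
have eq a : t%:C * psi1 a = r%:C * phi a.
  have := Tv a 1; rewrite rE innerZl inner_gns /s star_one !mul1r => <- //.
have rt : t%:C = r%:C by have := eq 1; rewrite (state1 s1) (state1 vector_state) !mulr1.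
apply/funext => a; have := eq a; rewrite -rt; apply: mulfI.
by apply/eqP => /complexI t00; move: t0; rewrite t00 ltxx.
Qed.

End VectorState.

End Purity.

(** * Crossed products *)

Lemma fsum_seq (V : zmodType) (T : choiceType) (r : seq T) (F : T -> V) :
  uniq r -> (forall i, i \notin r -> F i = 0) ->
  \sum_(i \in [set: T]) F i = \sum_(i <- r) F i.
Proof.
move=> ur F0; rewrite (fsbigE r)//; last by move=> i _; exact: F0.
by apply: eq_bigl => i; rewrite in_setT.
Qed.

Section Formal.
Context (G : groupType) (A : zmodType).
Implicit Types (l : seq (G * A)) (g h : G).

(* A list of pairs (g, a) stands for the formal sum of the a g. *)
Definition formal l h : A := \sum_(p <- l | p.1 == h) p.2.

Lemma formal_notin l h : h \notin map fst l -> formal l h = 0.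
Proof.
move=> hl; rewrite /formal big_seq_cond big1// => p /andP[pl /eqP ph].
by case/negP: hl; rewrite -ph; exact: map_f.
Qed.

Lemma formal_fin_supp l : fin_supp (formal l).
Proof.
apply: (@sub_finite_set _ _ [set` map fst l]); last exact: finite_seq.
by move=> h /= h0; apply: contraNT h0 => /formal_notin ->.
Qed.

Lemma fin_supp_formal (f : G -> A) : fin_supp f -> exists l, f = formal l.
Proof.
move=> /finite_seqP[r0 r0E]; pose r := undup r0.
have ur : uniq r by exact: undup_uniq.
have rE h : h \in r = (f h != 0).
  rewrite mem_undup; apply/idP/idP => [hr|fh].
    by have : [set` r0] h by []; rewrite -r0E.
  by have : [set g | f g != 0] h by []; rewrite r0E.
exists [seq (g, f g) | g <- r]; apply/funext => h; rewrite /formal big_map /=.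
rewrite -big_filter; have [fh|fh] := eqVneq (f h) 0.
  rewrite fh big1_seq// => g; rewrite mem_filter => /andP[_ /andP[/eqP -> _]] //.
rewrite (_ : [seq i <- r | i == h] = [:: h]) ?big_seq1//.
have hr : h \in r by rewrite rE.
by rewrite filter_pred1_uniq.
Qed.

(** Additivity in the coefficient merges repeated group elements. Lists with repetitions make linear
    combinations and products of formal sums simple list operations. *)
Lemma sum_formal (V : zmodType) (Phi : G -> A -> V) :
  (forall g a b, Phi g (a + b) = Phi g a + Phi g b) ->
  forall l, \sum_(g \in [set: G]) Phi g (formal l g) = \sum_(p <- l) Phi p.1 p.2.
Proof.
move=> PD l.
have P0 g : Phi g 0 = 0 by apply: (addrI (Phi g 0)); rewrite -PD !addr0.
rewrite (fsum_seq (r := undup (map fst l))) ?undup_uniq//; last first.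
  by move=> i; rewrite mem_undup => /formal_notin ->.
have : {subset map fst l <= undup (map fst l)} by move=> x; rewrite mem_undup.
move: (undup _) (undup_uniq (map fst l)) => r ur.
elim: l => [|p l IH] sub.
  by rewrite big_nil big1// => g _; rewrite /formal big_nil.
rewrite big_cons -IH; last by move=> x xl; apply: sub; rewrite inE xl orbT.
have pr : p.1 \in r by apply: sub; rewrite inE eqxx.
have fE g : Phi g (formal (p :: l) g) = (if p.1 == g then Phi g p.2 else 0) + Phi g (formal l g).
  by rewrite /formal big_cons; case: ifP => _; rewrite ?PD ?add0r.
under eq_bigr do rewrite fE.
rewrite big_split /=; congr (_ + _).
rewrite (bigD1_seq p.1)//= eqxx big1 ?addr0// => g /negPf gp.
by rewrite eq_sym gp.
Qed.

End Formal.

(** * Functionals extended from a dense family *)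

Section DenseExtension.
Context (R : realType) (B : cstarType R) (X : Type) (j : X -> B) (L : X -> R[i]) (K : R).
Hypothesis (jdense : forall b (e : R), 0 < e -> exists x, rnorm (b - j x) < e).
Hypothesis (jL : forall c x y, exists z, j z = c *: j x + j y /\ L z = c * L x + L y).
Hypotheses (K0 : 0 <= K) (LK : forall x, modulus (L x) <= K * rnorm (j x)).

(** X is a bare type (lists of terms in the application), so linearity is expressed by [jL].
    Together with the bound it makes L depend only on j x, and in a Lipschitz way. *)
Lemma dense_extension : exists psi : B -> R[i],
  [/\ scalar psi, forall b, modulus (psi b) <= K * rnorm b & forall x, psi (j x) = L x].
Proof.
have LB x y : modulus (L x - L y) <= K * rnorm (j x - j y).
  have [z [jz Lz]] := jL (-1) y x.
  by rewrite addrC -mulN1r -Lz [j x - _]addrC -scaleN1r -jz.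
have near b n : exists x, rnorm (b - j x) <= n.+1%:R^-1.
  have n0 : 0 < n.+1%:R^-1 :> R by rewrite invr_gt0.
  by have [x /ltW] := jdense b n0; exists x.
(* Requiring closeness to L x for every x, not only along a sequence, lets any approximation of b be
   used afterwards. *)
have /choice[psi psiP] : forall b, exists c, forall x,
    modulus (c - L x) <= K * rnorm (b - j x).
  move=> b; have /choice[u uP] := near b.
  have [|c cP] := @complex_complete_seq R K (fun n => L (u n)).
    move=> n m; rewrite (le_trans (LB _ _))// -mulrDr ler_wpM2l//.
    by rewrite (le_trans (rnorm_triangle _ b _))// lerD// rnormBC.
  exists c => x; rewrite -subr_le0; apply: (@le0_inv_nat _ (K + K + K)) => n.
  have := modulusD (c - L (u n)) (L (u n) - L x); rewrite addrA subrK.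
  have := cP n; rewrite modulusBC; have := LB (u n) x.
  have : K * rnorm (j (u n) - j x) <= K * (n.+1%:R^-1 + rnorm (b - j x)).
    by rewrite ler_wpM2l// (le_trans (rnorm_triangle _ b _))// lerD// rnormBC.
  by move: (n.+1%:R^-1 : R) => z; move=> *; lra.
have psij x : psi (j x) = L x.
  apply/subr0_eq/modulus_eq0/eqP; rewrite eq_le modulus_ge0 andbT.
  by rewrite (le_trans (psiP _ x))// subrr rnorm0 mulr0.
exists psi; split=> //.
- move=> c a b; apply/subr0_eq/modulus_eq0/eqP; rewrite eq_le modulus_ge0 andbT.
  apply: (@le0_inv_nat _ (K * (modulus c + 1) + (modulus c * K + K))) => n.
  have [x ax] := near a n; have [y yb] := near b n.
  have [z [jz Lz]] := jL c x y.
  have -> : psi (c *: a + b) - (c * psi a + psi b) = (psi (c *: a + b) - L z) -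
      (c * (psi a - L x) + (psi b - L y)) by rewrite Lz; ring.
  rewrite (le_trans (modulusD _ _))// modulusN mulrDl lerD//.
    rewrite (le_trans (psiP _ z))// -mulrA ler_wpM2l// jz opprD addrACA -scalerBr.
    by rewrite (le_trans (rnormD _ _))// mulrDl mul1r lerD// rnormZ ler_wpM2l ?modulus_ge0.
  rewrite (le_trans (modulusD _ _))// mulrDl lerD//.
    rewrite modulusM -mulrA ler_wpM2l ?modulus_ge0//.
    by rewrite (le_trans (psiP _ x))// ler_wpM2l.
  by rewrite (le_trans (psiP _ y))// ler_wpM2l.
- move=> b; rewrite -subr_le0; apply: (@le0_inv_nat _ (K + K)) => n.
  have [x bx] := near b n; have := psiP b x; have := LK x.
  have := modulusD (psi b - L x) (L x); rewrite subrK.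
  have : K * rnorm (j x) <= K * (rnorm b + n.+1%:R^-1).
    by rewrite ler_wpM2l// (le_trans (rnorm_sub_le _ b))// lerD2l rnormBC.
  have : K * rnorm (b - j x) <= K * n.+1%:R^-1 by rewrite ler_wpM2l.
  by move: (n.+1%:R^-1 : R) => z; move=> *; lra.
Qed.

Lemma dense_positive (psi : B -> R[i]) : scalar psi ->
  (forall b, modulus (psi b) <= K * rnorm b) ->
  (forall x, 0 <= psi (star (j x) * j x)) -> forall b, 0 <= psi (star b * b).
Proof.
move=> pl pK p0 b.
(* b^* b - y^* y = b^* (b - y) + (b - y)^* y, where |y| <= |b| + 1 because the approximation error
   is at most 1. *)
pose M := K * (rnorm b + (rnorm b + 1)).
have near n : exists2 c, 0 <= c & modulus (psi (star b * b) - c) <= M * n.+1%:R^-1.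
  have n0 : 0 < n.+1%:R^-1 :> R by rewrite invr_gt0.
  have n1 : n.+1%:R^-1 <= 1 :> R by rewrite invf_le1 ?ler1n.
  have [x bx] := jdense b n0; exists (psi (star (j x) * j x)) => //.
  have pB u v : psi (u - v) = psi u - psi v.
    exact: (linearB_of (pl : linear (psi : B -> R[i]^o))).
  rewrite -pB (le_trans (pK _))//.
  have -> : star b * b - star (j x) * j x = star b * (b - j x) + star (b - j x) * j x.
    by rewrite mulrBr starD starN mulrBl addrA subrK.
  have h := rnormD (star b * (b - j x)) (star (b - j x) * j x).
  have h1 := rnormM (star b) (b - j x); have h2 := rnormM (star (b - j x)) (j x).
  rewrite !rnorm_star in h1 h2.
  have h3 := rnorm_sub_le (j x) b; rewrite rnormBC in h3.
  have h4 := rnorm_ge0 (b - j x); have h5 := rnorm_ge0 b; have h6 := rnorm_ge0 (j x).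
  rewrite /M -mulrA ler_wpM2l// (le_trans h)// mulrDl lerD//.
    by rewrite (le_trans h1)// ler_wpM2l// ltW.
  rewrite (le_trans h2)// mulrC ler_pM//; last exact: ltW.
  by rewrite (le_trans h3)// lerD2l ltW// (lt_le_trans bx).
rewrite lecE; apply/andP; split.
  rewrite -normr_eq0 eq_le normr_ge0 andbT /=; apply: (@le0_inv_nat _ M) => n.
  have [c c0 cn] := near n; rewrite (le_trans _ cn)//.
  have := Im_le_modulus (psi (star b * b) - c); have := ger0_Im c0.
  by case: c {c0 cn} => u v; case: (psi _) => s t /= ->; rewrite subr0.
rewrite -oppr_le0; apply: (@le0_inv_nat _ M) => n.
have [c c0 cn] := near n; rewrite (le_trans _ cn)//.
have := Re_le_modulus (psi (star b * b) - c); move: c0; rewrite lecE => /andP[_] /=.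
rewrite ReD ReN ler_norml => c0 /andP[]; move: c0.
by move: (complex.Re c) (modulus _) (complex.Re _) => x y z /=; lra.
Qed.

End DenseExtension.

Lemma gns_rep1 (R : realType) (A : cstarType R) (f : A -> R[i]) (fp : positive f)
  (F : gns fp) : gns_rep 1 F = F.
Proof. by apply: antidualP => b /=; rewrite star_one mul1r. Qed.

Section Crossed.
Context (R : realType) (G : groupType) (A : cstarType R) (alpha : G -> A -> A).
Hypothesis act : action_by_automorphisms alpha.

Lemma alpha_morphism g : star_morphism (alpha g).
Proof. by case: (action_auto act g). Qed.

Lemma alphaM g h a : alpha (g * h)%g a = alpha g (alpha h a).
Proof. by rewrite (actionM act). Qed.

(** alpha_1 is idempotent by multiplicativity and injective as an automorphism. *)
Lemma alpha1 a : alpha 1%g a = a.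
Proof.
have [_ [f fK _]] := action_auto act 1%g.
by rewrite -[LHS]fK -alphaM mulg1 fK.
Qed.

Lemma alphaK g a : alpha g^-1%g (alpha g a) = a.
Proof. by rewrite -alphaM mulVg alpha1. Qed.

(* The product f^* f of the formal sum f, using g^-1 a h = alpha_(g^-1)(a) g^-1 h. *)
Definition formal_starM (l : seq (G * A)) : seq (G * A) :=
  [seq ((p.1^-1 * q.1)%g, alpha p.1^-1%g (star p.2 * q.2)) | p <- l, q <- l].

Section Product.
Context (nrm : (G -> A) -> \bar R) (B : cstarType R) (iota : A -> B) (u : G -> B).
Hypothesis cp : crossed_product_for alpha nrm iota u.

Definition crossed_sum (l : seq (G * A)) : B := \sum_(p <- l) iota p.2 * u p.1.

Let im := crossed_iota cp.

Lemma crossed_iotaD a b : iota (a + b) = iota a + iota b.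
Proof. exact: linearD_of (star_morphism_linear im) _ _. Qed.

Lemma crossed_sumE l :
  \sum_(g \in [set: G]) iota (formal l g) * u g = crossed_sum l.
Proof.
by apply: (@sum_formal G A B (fun g a => iota a * u g)) => g a b; rewrite crossed_iotaD mulrDl.
Qed.

Lemma crossed_sum_norm l : (rnorm (crossed_sum l))%:E = nrm (formal l).
Proof. by rewrite -crossed_sumE; apply: (crossed_norm cp); exact: formal_fin_supp. Qed.

Lemma crossed_sum_dense b (e : R) : 0 < e -> exists l, rnorm (b - crossed_sum l) < e.
Proof.
move=> e0; have : [set: B] b by [].
rewrite -(crossed_dense cp) => /closureP/(_ e e0)[_ [f ff <-]].
by have [l ->] := fin_supp_formal ff; rewrite crossed_sumE; exists l.
Qed.

Lemma crossed_sum_linear c l l' :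
  crossed_sum ([seq (p.1, c *: p.2) | p <- l] ++ l') =
  c *: crossed_sum l + crossed_sum l'.
Proof.
rewrite /crossed_sum big_cat big_map /= scaler_sumr; congr (_ + _).
by apply: eq_bigr => p _; rewrite (linearZ_of (star_morphism_linear im)) -scaleAl.
Qed.

Lemma crossed_u1 : u 1%g = 1.
Proof.
have [uu _] := crossed_u_unitary cp 1%g.
by rewrite -[LHS]mul1r -uu -mulrA -(crossed_uM cp) mulg1 uu.
Qed.

Lemma crossed_star_u g : star (u g) = u g^-1%g.
Proof.
have [_ uu] := crossed_u_unitary cp g.
by rewrite -[LHS]mul1r -crossed_u1 -(mulVg g) (crossed_uM cp) -mulrA uu mulr1.
Qed.

Lemma crossed_starM l :
  crossed_sum (formal_starM l) = star (crossed_sum l) * crossed_sum l.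
Proof.
rewrite /crossed_sum (big_morph star (@starD R B) (star0 B)) big_allpairs_dep.
rewrite mulr_suml; apply: eq_bigr => p _; rewrite mulr_sumr; apply: eq_bigr => q _ /=.
rewrite -(crossed_covariant cp) (crossed_uM cp) -crossed_star_u starK star_mul.
rewrite (star_morphismM im) (star_morphism_star im) !mulrA; congr (_ * _).
rewrite -!mulrA; congr (_ * (_ * _)).
by have [_ ->] := crossed_u_unitary cp p.1; rewrite mulr1.
Qed.

(** The common source of states on both products, used for vectors of the regular representation and
    for lifting. The norm bound gives the extension by density; positivity on formal f^* f passes to
    the closure. *)
Lemma crossed_state (lam : G -> A -> R[i]) : (forall g, scalar (lam g)) ->
  (forall l, modulus (\sum_(p <- l) lam p.1 p.2) <= rnorm (crossed_sum l)) ->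
  (forall l, 0 <= \sum_(p <- formal_starM l) lam p.1 p.2) -> lam 1%g 1 = 1 ->
  exists2 psi : B -> R[i], state psi & forall g a, psi (iota a * u g) = lam g a.
Proof.
move=> ll lb lp l1; pose L (l : seq (G * A)) := \sum_(p <- l) lam p.1 p.2.
have [|||psi [pl pb pE]] := @dense_extension R B _ crossed_sum L 1 crossed_sum_dense.
- move=> c l l'; exists ([seq (p.1, c *: p.2) | p <- l] ++ l'); split.
    exact: crossed_sum_linear.
  rewrite /L big_cat big_map /= mulr_sumr; congr (_ + _); apply: eq_bigr => p _.
  exact: (linearZ_of (ll p.1 : linear (lam p.1 : A -> R[i]^o))).
- exact: ler01.
- by move=> l; rewrite mul1r; exact: lb.
have pE1 g a : psi (iota a * u g) = lam g a.
  by have := pE [:: (g, a)]; rewrite /crossed_sum /L !big_seq1.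
exists psi => //; split => //.
- apply: (dense_positive crossed_sum_dense ler01 pl pb) => l.
  by rewrite -crossed_starM pE; exact: lp.
- by rewrite -l1 -pE1 crossed_u1 mulr1 (star_morphism1 im).
Qed.

Lemma crossed_state_ext (psi psi' : B -> R[i]) : state psi -> state psi' ->
  (forall g a, psi (iota a * u g) = psi' (iota a * u g)) -> psi = psi'.
Proof.
move=> /state_positive pp /state_positive pp' E; apply/funext => b.
apply/subr0_eq/modulus_eq0/eqP; rewrite eq_le modulus_ge0 andbT.
apply: (@le0_inv_nat _ (complex.Re (psi 1) + complex.Re (psi' 1))) => n.
have n0 : 0 < n.+1%:R^-1 :> R by rewrite invr_gt0.
have [l bl] := crossed_sum_dense b n0.
have El : psi (crossed_sum l) = psi' (crossed_sum l).
  rewrite /crossed_sum (big_morph psi (positiveD pp) (positive0 pp)).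
  rewrite (big_morph psi' (positiveD pp') (positive0 pp')).
  by apply: eq_bigr => p _; exact: E.
have -> : psi b - psi' b = psi (b - crossed_sum l) - psi' (b - crossed_sum l).
  by rewrite (positiveB pp) (positiveB pp') El opprB addrA subrK.
rewrite (le_trans (modulusD _ _))// modulusN mulrDl lerD//.
  rewrite (le_trans (positive_bound pp _))// ler_wpM2l ?positive_one_ge0//; exact: ltW.
by rewrite (le_trans (positive_bound pp' _))// ler_wpM2l ?positive_one_ge0//; exact: ltW.
Qed.

End Product.

(** Sums over G are kept as sums over lists that contain the support; this is translation invariance
    in that form, with zero terms in T' outside g T. *)
Lemma reindex_mul (V : zmodType) (T T' : seq G) (g : G) (F : G -> V) :
  uniq T -> uniq T' -> (forall t, t \in T -> (g * t)%g \in T') ->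
  (forall t, (g^-1 * t)%g \notin T -> F t = 0) ->
  \sum_(t <- T) F (g * t)%g = \sum_(t <- T') F t.
Proof.
move=> uT uT' TT' F0.
rewrite -(big_map (fun t => g * t)%g xpredT F).
rewrite [RHS](bigID (fun t => g^-1 * t \in T)%g) /= [X in _ + X]big1 ?addr0//.
rewrite -[RHS]big_filter; apply: perm_big; apply: uniq_perm.
- by rewrite map_inj_uniq//; exact: mulgI.
- exact: filter_uniq.
- move=> t; rewrite mem_filter; apply/mapP/andP => [[s sT ->]|[tT _]].
    by rewrite mulKg sT TT'.
  by exists (g^-1 * t)%g => //; rewrite mulgA mulgV mul1g.
Qed.

Lemma sum_CS (I : Type) (s : seq I) (a b : I -> R) :
  \sum_(i <- s) b i ^+ 2 = 1 ->
  (\sum_(i <- s) a i * b i) ^+ 2 <= \sum_(i <- s) a i ^+ 2.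
Proof.
move=> b1; pose c := \sum_(i <- s) a i * b i.
have : 0 <= \sum_(i <- s) (a i - c * b i) ^+ 2 by apply: sumr_ge0 => i _; exact: sqr_ge0.
have -> : \sum_(i <- s) (a i - c * b i) ^+ 2 =
    \sum_(i <- s) a i ^+ 2 - 2 * c * (\sum_(i <- s) a i * b i) + c ^+ 2 * \sum_(i <- s) b i ^+ 2.
  have E i : (a i - c * b i) ^+ 2 = a i ^+ 2 - 2 * c * (a i * b i) + c ^+ 2 * b i ^+ 2 by ring.
  by rewrite (eq_bigr _ (fun i _ => E i)) big_split /= sumrB -!mulr_sumr.
by rewrite b1 -/c => h; lra.
Qed.

(** * States from finitely supported vectors of the regular representation *)

Section Regular.
Context (H : hilbertType R) (pi : A -> H -> H) (rp : representation pi).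
Context (eta : G -> H) (T : seq G).
Hypotheses (uT : uniq T) (etaT : forall t, t \notin T -> eta t = 0)
  (eta1 : \sum_(t <- T) rnorm (eta t) ^+ 2 = 1).

Definition regular_vec (l : seq (G * A)) (t : G) : H :=
  \sum_(p <- l) pi (alpha t^-1%g p.2) (eta (p.1^-1 * t)%g).

Lemma integrated_regular l :
  integrated (regular_pi alpha pi) (@regular_U R G H) (formal l) eta = regular_vec l.
Proof.
rewrite /integrated (@sum_formal G A _ (fun g a => regular_pi alpha pi a (regular_U g eta))).
  by apply/funext => t; rewrite fct_sumE.
move=> g a b; apply/funext => t; rewrite /regular_pi.
rewrite (linearD_of (star_morphism_linear (alpha_morphism _))).
exact: (linearD_of (rep_linear rp _)).
Qed.

(** The matrix coefficient <a g eta, eta>; the sum over T is the whole inner product because eta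
    vanishes off T. *)
Definition regular_coef g a : R[i] :=
  \sum_(t <- T) inner (pi (alpha t^-1%g a) (eta (g^-1 * t)%g)) (eta t).

Lemma regular_coef_sum l : \sum_(p <- l) regular_coef p.1 p.2 =
  \sum_(t <- T) inner (regular_vec l t) (eta t).
Proof.
rewrite /regular_coef exchange_big; apply: eq_bigr => t _ /=.
by rewrite /regular_vec (big_morph (fun x => inner x (eta t)) (fun x y => innerDl x y _) (inner0l _)).
Qed.

Lemma regular_coef_scalar g : scalar (regular_coef g).
Proof.
move=> c a b; rewrite /regular_coef mulr_sumr -big_split; apply: eq_bigr => t _ /=.
by rewrite (star_morphism_linear (alpha_morphism _)) (rep_linear rp) innerDl innerZl.
Qed.

(** Cauchy-Schwarz against the unit vector eta on T, enlargement of T to G, the operator norm tested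
    at eta, and the supremum over all pi, in this order. *)
Lemma regular_coef_bound l :
  ((modulus (\sum_(p <- l) regular_coef p.1 p.2))%:E <= reduced_norm alpha (formal l))%E.
Proof.
rewrite regular_coef_sum.
apply: (@le_trans _ _ (l2norm (regular_vec l))).
  pose S := \sum_(t <- T) rnorm (regular_vec l t) ^+ 2.
  have S0 : 0 <= S by apply: sumr_ge0 => t _; exact: sqr_ge0.
  apply: (@le_trans _ _ (Num.sqrt S)%:E).
    rewrite lee_fin -[leLHS]ger0_norm ?modulus_ge0// -sqrtr_sqr ler_wsqrtr//.
    rewrite (le_trans _ (sum_CS (fun t => rnorm (regular_vec l t)) eta1))//.
    rewrite ler_pXn2r ?nnegrE ?modulus_ge0 ?sumr_ge0//; last first.
      by move=> t _; rewrite mulr_ge0 ?rnorm_ge0.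
    elim: (T) => [|t r IH]; first by rewrite !big_nil modulus0.
    by rewrite !big_cons (le_trans (modulusD _ _))// lerD// inner_CS.
  rewrite -[(Num.sqrt S)%:E]/(sqrte S%:E) /l2norm lee_sqrt; last first.
    by apply: esum_ge0 => t _; rewrite lee_fin sqr_ge0.
  apply: esum_ge; exists [set` T]; first by split=> //; exact: finite_seq.
  by rewrite -fsbig_seq// sumEFin.
rewrite -integrated_regular.
apply: (@le_trans _ _ (opnorm (@l2norm R G H) (integrated (regular_pi alpha pi) (@regular_U R G H) (formal l)))).
  apply: ereal_sup_ubound; exists eta => //=.
  rewrite /l2norm.
  have -> : \esum_(t in [set: G]) (rnorm (eta t) ^+ 2)%:E = 1%:E.
    rewrite -eta1 -sumEFin fsbig_seq// -esum_fset; [|exact: finite_seq|].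
      rewrite [RHS]esum_mkcond; apply: eq_esum => t _.
      by case: ifPn => // /negP tT; rewrite etaT ?rnorm0 ?expr0n//; apply/negP => h;
        apply: tT; rewrite inE.
    by move=> t _; rewrite lee_fin sqr_ge0.
  by rewrite /= sqrtr1.
by apply: ereal_sup_ubound; exists H, pi.
Qed.

Lemma regular_coef_positive l :
  0 <= \sum_(p <- formal_starM l) regular_coef p.1 p.2.
Proof.
(* T' contains the support of f eta for the formal sum f of l, so the sum over T' below is the full
   square |f eta|^2. *)
pose T' := undup [seq (p.1 * t)%g | p <- l, t <- T].
have uT' : uniq T' by exact: undup_uniq.
suff -> : \sum_(p <- formal_starM l) regular_coef p.1 p.2 =
    \sum_(t <- T') inner (regular_vec l t) (regular_vec l t).
  by apply: sumr_ge0 => t _; exact: inner_ge0.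
pose F t (p q : G * A) := inner (pi (alpha t^-1%g q.2) (eta (q.1^-1 * t)%g))
  (pi (alpha t^-1%g p.2) (eta (p.1^-1 * t)%g)).
transitivity (\sum_(p <- l) \sum_(q <- l) \sum_(t <- T') F t p q).
  rewrite big_allpairs_dep big_seq [RHS]big_seq; apply: eq_bigr => p pl.
  apply: eq_bigr => q _ /=.
  (* For fixed p the terms live on p.1 T, and shifting back by p.1 turns <q eta, p eta> into <p^* q
     eta, eta>. *)
  rewrite -(@reindex_mul _ T T' p.1 (fun t => F t p q))//; last 2 first.
  - by move=> t tT; rewrite mem_undup; apply/allpairsP; exists (p, t).
  - by move=> t /etaT; rewrite /F => ->;
    rewrite (linear0_of (rep_op_linear rp _)) inner0r.
  apply: eq_bigr => t _; rewrite /F mulKg invgM -alphaM -[in RHS]rep_starM//.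
  have am := alpha_morphism (t^-1 * p.1^-1)%g.
  by rewrite !invgM invgK mulgA -(star_morphism_star am) -(star_morphismM am).
rewrite exchange_big /=.
transitivity (\sum_(q <- l) \sum_(t <- T') \sum_(p <- l) F t p q).
  by apply: eq_bigr => q _; exact: exchange_big.
rewrite exchange_big /=; apply: eq_bigr => t _; rewrite exchange_big /=.
rewrite {2}/regular_vec (big_morph (fun x => inner (regular_vec l t) x) (fun x y => innerDr x y _) (inner0r _)).
apply: eq_bigr => p _; rewrite /regular_vec.
by rewrite (big_morph (fun x => inner x (pi (alpha t^-1%g p.2) (eta (p.1^-1 * t)%g))) (fun x y => innerDl x y _) (inner0l _)).
Qed.

Lemma regular_state (piu : forall x, pi 1 x = x) (B : cstarType R) (iota : A -> B) (u : G -> B) :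
  reduced_crossed_product alpha iota u ->
  exists2 psi : B -> R[i], state psi & forall g a, psi (iota a * u g) = regular_coef g a.
Proof.
move=> cp; apply: (crossed_state cp).
- exact: regular_coef_scalar.
- by move=> l; rewrite -lee_fin (crossed_sum_norm cp); exact: regular_coef_bound.
- exact: regular_coef_positive.
- rewrite /regular_coef -[RHS]/((1 : R)%:C) -eta1 rmorph_sum; apply: eq_bigr => t _ /=.
  by rewrite (star_morphism1 (alpha_morphism _)) piu invg1 mul1g innerE.
Qed.

End Regular.

(** The GNS space of psi carries a covariant pair, one of those over which [full_norm] is a
    supremum, so the coefficients of psi are bounded by the full norm and define a state there. *)
Lemma lift_state (Br : cstarType R) (iotar : A -> Br) (ur : G -> Br)
  (Bf : cstarType R) (iotaf : A -> Bf) (uf : G -> Bf) (psi : Br -> R[i]) :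
  reduced_crossed_product alpha iotar ur -> full_crossed_product alpha iotaf uf ->
  state psi -> exists2 psi' : Bf -> R[i], state psi' &
    forall g a, psi' (iotaf a * uf g) = psi (iotar a * ur g).
Proof.
move=> cr cf ps; have pp := state_positive ps.
have im := crossed_iota cr.
have rp := gns_representation pp.
pose pi a : gns pp -> gns pp := gns_rep (iotar a).
pose U g : gns pp -> gns pp := gns_rep (ur g).
have cov : covariant_rep alpha pi U.
  split.
  - split.
    + by move=> a; exact: (rep_op_linear rp).
    + by move=> a; exact: (rep_op_continuous rp).
    + by move=> x c a b; rewrite /pi (star_morphism_linear im) (rep_linear rp).
    + by move=> a b x; rewrite /pi (star_morphismM im) (repM rp).
    + by move=> a x y; rewrite /pi (star_morphism_star im) (rep_star rp).
  - by move=> x; rewrite /pi (star_morphism1 im) gns_rep1.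
  - split.
    + by move=> g; exact: (rep_op_linear rp).
    + move=> g x y; rewrite /U -rep_starM//; have [-> _] := crossed_u_unitary cr g.
      by rewrite gns_rep1.
    + by move=> x; rewrite /U (crossed_u1 cr) gns_rep1.
    + by move=> g h x; rewrite /U (crossed_uM cr) (repM rp).
  - move=> g a x; rewrite /U /pi -(crossed_covariant cr) !(repM rp) (crossed_star_u cr)//.
have L l : psi (crossed_sum iotar ur l) = \sum_(p <- l) psi (iotar p.2 * ur p.1).
  by rewrite /crossed_sum (big_morph psi (positiveD pp) (positive0 pp)).
apply: (crossed_state cf (lam := fun g a => psi (iotar a * ur g))).
- move=> g c a b.
  by rewrite (star_morphism_linear im) mulrDl -scaleAl (positive_linear pp).
- move=> l; rewrite -L -lee_fin (crossed_sum_norm cf).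
  pose xi := gns_vec pp 1.
  have xi1 : rnorm xi = 1 by apply: gns_vec1_norm; exact: state1 ps.
  have E : integrated pi U (formal l) xi = gns_vec pp (crossed_sum iotar ur l).
    rewrite /integrated (@sum_formal G A _ (fun g a => pi a (U g xi))).
      rewrite /crossed_sum.
      rewrite (big_morph (gns_vec pp) (id1 := 0) (op1 := +%R)).
      + apply: eq_bigr => p _; rewrite /pi /U /xi !gns_rep_vec mulr1//.
      + by move=> x y; apply: antidualP => b; rewrite /= mulrDr (positiveD pp).
      + by apply: antidualP => b; rewrite /= mulr0 (positive0 pp).
    move=> g a b; rewrite /pi (crossed_iotaD cr); exact: (linearD_of (rep_linear rp _)).
  apply: (@le_trans _ _ (rnorm (integrated pi U (formal l) xi))%:E).
    rewrite lee_fin E; have := inner_CS (gns_vec pp (crossed_sum iotar ur l)) xi.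
    by rewrite inner_gns star_one mul1r xi1 mulr1.
  apply: (@le_trans _ _ (opnorm (fun x : gns pp => (rnorm x)%:E) (integrated pi U (formal l)))).
    by apply: ereal_sup_ubound; exists xi => //=; rewrite xi1.
  by apply: ereal_sup_ubound; exists (gns pp), pi, U.
- by move=> l; rewrite -L (crossed_starM cr) (positive_ge0 pp).
- by rewrite (star_morphism1 im) (crossed_u1 cr) mulr1 (state1 ps).
Qed.

End Crossed.

(** * The pure extension property and freeness *)

Section UnitaryEquivalence.
Context (R : realType) (A : cstarType R).
Implicit Types pi rho sigma : irrep A.

Lemma unitarily_equivalent_refl pi : unitarily_equivalent pi pi.
Proof. by exists id; split=> // y; exists y. Qed.

Lemma unitarily_equivalent_trans pi rho sigma : unitarily_equivalent pi rho ->
  unitarily_equivalent rho sigma -> unitarily_equivalent pi sigma.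
Proof.
move=> [U [Ul Ui Us UE]] [V [Vl Vi Vs VE]]; exists (V \o U); split => /=.
- by move=> c x y; exact: etrans (congr1 V (Ul c x y)) (Vl _ _ _).
- by move=> x y; rewrite Vi.
- by move=> y; have [z <-] := Vs y; have [x <-] := Us z; exists x.
- by move=> a x; rewrite UE VE.
Qed.

Lemma unitarily_equivalent_sym pi rho : unitarily_equivalent pi rho ->
  unitarily_equivalent rho pi.
Proof.
move=> [U [Ul Ui /choice[V UV] UE]].
have Uinj x y : U x = U y -> x = y.
  move=> xy; apply/subr0_eq/inner_eq0; rewrite -Ui (linearB_of Ul) xy subrr.
  exact: inner0l.
exists V; split.
- by move=> c x y; apply: Uinj; rewrite Ul !UV.
- by move=> x y; rewrite -Ui !UV.
- by move=> x; exists (U x); apply: Uinj; rewrite UV.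
- by move=> a x; apply: Uinj; rewrite UE !UV.
Qed.

Lemma irrep_class_eq pi rho : irrep_class pi = irrep_class rho <->
  unitarily_equivalent pi rho.
Proof.
split=> [e|e].
  have : irrep_class rho rho by exact: unitarily_equivalent_refl.
  by rewrite -e.
apply/funext => sigma; apply/propext; split; apply: unitarily_equivalent_trans => //.
exact: unitarily_equivalent_sym.
Qed.

End UnitaryEquivalence.

Section Main.
Context (R : realType) (G : groupType) (A : cstarType R) (alpha : G -> A -> A).
Hypothesis act : action_by_automorphisms alpha.

Lemma crossed_iota1 (nrm : (G -> A) -> \bar R) (B : cstarType R) (iota : A -> B)
  (u : G -> B) : crossed_product_for alpha nrm iota u -> forall a, iota a * u 1%g = iota a.
Proof. by move=> cp a; rewrite (crossed_u1 cp) mulr1. Qed.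

Section Reduced.
Context (Br : cstarType R) (iotar : A -> Br) (ur : G -> Br).
Hypothesis cr : reduced_crossed_product alpha iotar ur.

(** The state is the vector state of delta_e (x) xi, with xi the GNS cyclic vector: phi composed
    with the canonical conditional expectation onto A. *)
Lemma state_extension_reduced (phi : A -> R[i]) : state phi ->
  exists2 psi : Br -> R[i], state psi & psi \o iotar = phi.
Proof.
move=> ps; have pp := state_positive ps.
pose eta (t : G) : gns pp := if t == 1%g then gns_vec pp 1 else 0.
have [||||psi sp pE] := @regular_state R G A alpha act _ _ (gns_representation pp)
    eta [:: 1%g] _ _ _ _ Br iotar ur cr.
- by [].
- by move=> t; rewrite inE /eta => /negPf ->.
- by rewrite big_seq1 /eta eqxx gns_vec1_norm ?expr1n//; exact: state1 ps.
- exact: gns_rep1.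
exists psi => //; apply/funext => a /=; rewrite -(crossed_iota1 cr) pE.
rewrite /regular_coef big_seq1 invg1 mulg1 /eta eqxx (alpha1 act) gns_rep_vec inner_gns.
by rewrite star_one mul1r mulr1.
Qed.

Lemma free_of_pep : pure_extension_property iotar -> free_on_spectrum act.
Proof.
move=> pep g g1 [x [[pi ->]]]; rewrite spectrum_act_class => /irrep_class_eq.
have rp := irrep_rep pi; have irr := irrep_irr pi.
case: pi rp irr => H pi r_pi i_pi /= rp irr [V [/= Vl Vi _ VE0]].
have VE a y : V (pi a y) = pi (alpha g^-1%g a) (V y).
  by rewrite -VE0 -(alphaM act) mulgV (alpha1 act).
have [xi xi1] : exists xi : H, rnorm xi = 1.
  have [a [y ay]] := irr.1; exists ((rnorm y)^-1%:C *: y).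
  rewrite rnormZ modulus_real ger0_norm ?invr_ge0 ?rnorm_ge0// mulVf//.
  by apply: contra_neq ay => /rnorm_eq0 ->; exact: linear0_of (rep_op_linear rp a).
have xi0 : xi != 0.
  by apply/eqP => h; move: xi1; rewrite h rnorm0 => /esym/eqP; rewrite oner_eq0.
have Vn y : rnorm (V y) = rnorm y.
  apply/eqP; rewrite -(@eqrXn2 _ 2) ?rnorm_ge0//; apply/eqP/complexI.
  by rewrite -!innerE Vi.
have pi1 := irreducible_unital rp irr.
pose phi a := inner (pi a xi) xi.
have pure : pure_state phi by exact: vector_state_pure.
pose r : R := Num.sqrt 2^-1.
have r2 : r * r = 2^-1 by rewrite -expr2 sqr_sqrtr// invr_ge0.
have r0 : 0 <= r by exact: sqrtr_ge0.
pose eta (c : R[i]) (t : G) : H := if t == 1%g then r%:C *: xi else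
  if t == g then (r%:C * c) *: V xi else 0.
have g1' : (g == 1%g) = false by apply/eqP.
(* The second cross term appears exactly when g is an involution: translation by g then also carries
   the component at g to the one at e. *)
have ext (c : R[i]) : modulus c = 1 -> exists psi : Br -> R[i],
    [/\ state psi, psi \o iotar = phi & forall a, psi (iotar (alpha g a) * ur g) =
      (2^-1)%:C * ((c^*)%R * inner (pi a xi) (V xi) +
        c * (if g^-1%g == g then inner (pi (alpha g a) (V xi)) xi else 0))].
  move=> c1.
  have [|||psi sp pE] := @regular_state R G A alpha act _ _ rp (eta c)
     [:: 1%g; g] _ _ _ pi1 Br iotar ur cr.
  - by rewrite /= inE eq_sym g1'.
  - by move=> t; rewrite !inE negb_or /eta => /andP[/negPf -> /negPf ->].
  - rewrite !big_cons big_nil addr0 /eta eqxx g1' eqxx !rnormZ modulusM modulus_real.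
    by rewrite c1 Vn xi1 !mulr1 ger0_norm// !expr2 r2; lra.
  exists psi; split=> //.
    apply/funext => a /=; rewrite -(crossed_iota1 cr) pE /regular_coef.
    rewrite !big_cons big_nil addr0 invg1 !mul1g /eta eqxx g1' eqxx (alpha1 act).
    rewrite !(linearZ_of (rep_op_linear rp _)) -VE !innerZl !innerZr Vi.
    rewrite !mulrA rmorphM /= conj_real.
    have -> : r%:C * c * (r%:C * (c^*)%R) = r%:C * r%:C * (c * (c^*)%R) by ring.
    rewrite conjM_modulus c1 expr1n mulr1 -rmorphM /= r2 -mulrDl -rmorphD /=.
    have -> : 2^-1 + 2^-1 = 1 :> R by lra.
    by rewrite mul1r.
  move=> a; rewrite pE /regular_coef !big_cons big_nil addr0 invg1 mulg1 mulVg.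
  rewrite /eta !eqxx g1' (alpha1 act) (alphaK act).
  have -> : (g^-1%g == 1%g) = false.
    by apply/eqP => h; apply: g1; rewrite -[g]invgK h invg1.
  rewrite !(linearZ_of (rep_op_linear rp _)) !innerZl !innerZr rmorphM /= conj_real.
  case: ifP => _.
    rewrite (linearZ_of (rep_op_linear rp _)) innerZl.
    have -> : (2^-1 : R)%:C = r%:C * r%:C by rewrite -rmorphM /= r2.
    by ring.
  rewrite (linear0_of (rep_op_linear rp _)) inner0l.
  have -> : (2^-1 : R)%:C = r%:C * r%:C by rewrite -rmorphM /= r2.
  by ring.
have m1 : modulus (1 : R[i]) = 1 by rewrite modulus_real normr1.
have mN1 : modulus (-1 : R[i]) = 1 by rewrite modulusN.
have mi : modulus ('i%C : R[i]) = 1.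
  by rewrite /modulus normc_def /= expr0n expr1n add0r sqrtr1.
have [psi [_ uniq]] := pep phi pure.
(* The coefficient at g is (c^* X + c Y) / 2. Equality for c = 1 and c = -1 gives X + Y = 0, and c =
   i then gives Y - X = 0, so X = 0 even if g is an involution. *)
have [p1 [s1 e1 E1]] := ext 1 m1.
have [p2 [s2 e2 E2]] := ext (-1) mN1.
have [p3 [s3 e3 E3]] := ext 'i%C mi.
have p12 : p1 = p2 by rewrite -(uniq p1 (conj s1 e1)) (uniq p2 (conj s2 e2)).
have p13 : p1 = p3 by rewrite -(uniq p1 (conj s1 e1)) (uniq p3 (conj s3 e3)).
have X0 a : inner (pi a xi) (V xi) = 0.
  have := E1 a; have := E2 a; have := E3 a; rewrite -p12 -p13.
  move: (inner (pi a xi) _) (if _ then _ else _) (p1 _) => X Y z -> h1 h2.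
  move: h1 h2; case: X => X1 X2; case: Y => Y1 Y2 /= [a1 a2] [b1 b2].
  by congr (_ +i* _); lra.
(* V xi is a unit vector orthogonal to every pi(a) xi, so its distance to each of them is at least
   1, against cyclicity of xi. *)
have [a ax] := irreducible_cyclic rp irr xi0 (V xi) ltr01.
have := inner_CS (V xi - pi a xi) (V xi); rewrite innerDl innerNl X0 subr0 innerE.
by rewrite modulus_real Vn xi1 expr1n mulr1 normr1 leNgt ax.
Qed.

End Reduced.

Section Full.
Context (Bf : cstarType R) (iotaf : A -> Bf) (uf : G -> Bf).
Hypothesis cf : full_crossed_product alpha iotaf uf.

Lemma free_coefficient (phi : A -> R[i]) (psi : Bf -> R[i]) (g : G) :
  free_on_spectrum act -> pure_state phi -> state psi -> psi \o iotaf = phi ->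
  g <> 1%g -> forall a, psi (iotaf a * uf g) = 0.
Proof.
move=> free pure sp e g1 a0; apply: contrapT => a0n.
have pp := state_positive pure.1; have qq := state_positive sp.
have im := crossed_iota cf.
have pE a : psi (iotaf a) = phi a by rewrite -e.
(* Cauchy-Schwarz for psi, with u g unitary and psi equal to phi on A, bounds this form by the GNS
   form. *)
pose s (a b : gns_pre pp) : R[i] := psi (star (iotaf b) * (uf g * iotaf a)).
have [uu uu'] := crossed_u_unitary cf g.
have [||| T [Tl T1 TE]] := @sesq_operator R (gns_pre pp) s.
- move=> b c x y; rewrite /s (star_morphism_linear im) !mulrDr -!scaleAr.
  exact: (positive_linear qq).
- move=> c x y z; rewrite /s (star_morphism_linear im) starD starZ mulrDl -scaleAl.
  exact: (positive_linear qq).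
- move=> a b; rewrite (le_trans (positive_CS qq _ _))// !qform_gns.
  rewrite star_mul -[_ * (uf g * iotaf a)]mulrA [star (uf g) * _]mulrA uu mul1r.
  by rewrite -!(star_morphism_star im) -!(star_morphismM im) !pE.
pose rep := @gns_rep _ _ _ pp; have rr : representation rep by exact: gns_representation.
pose irp : irrep A := Irrep rr (pure_gns_irreducible pp pure).
have af := action_auto act g.
have rr' := representation_twist af rr.
have irr' := irreducible_twist af (pure_gns_irreducible pp pure).
have Tcomm a F : T (rep a F) = rep (alpha g a) (T F).
  apply/subr0_eq; pose f (F : antidual (gns_pre pp)) : gns pp := T (rep a F) - rep (alpha g a) (T F).
  have fl : linear f.
    move=> c x y; rewrite /f (rep_op_linear rr) !Tl (rep_op_linear rr).
    by rewrite scalerBr opprD addrACA.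
  apply: (linear_eq0_on_embed fl (K := rnorm a + rnorm (alpha g a))).
    move=> X; rewrite (le_trans (rnormD _ _))// rnormN mulrDl lerD//.
      by rewrite (le_trans (T1 _))//; exact: (rep_bound rr).
    rewrite (le_trans (rep_bound rr _ _))// ler_wpM2l ?rnorm_ge0//; exact: T1.
  move=> v; apply/eqP; rewrite subr_eq0; apply/eqP; apply: antidualP => b.
  have -> : rep a (embed v) = @embed R (gns_pre pp) (a * (v : A)) by exact: gns_rep_vec.
  rewrite TE /= TE /s.
  have -> : star (iotaf (star (alpha g a) * (b : A))) = star (iotaf b) * iotaf (alpha g a).
    by rewrite -(star_morphism_star im) star_mul starK (star_morphismM im) (star_morphism_star im).
  rewrite (star_morphismM im) -!mulrA; congr (psi (_ * _)).
  by rewrite -(crossed_covariant cf) !mulrA -[_ * star (uf g) * uf g]mulrA uu mulr1.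
pose xi := gns_vec pp 1.
have piv a : rep a xi = gns_vec pp a by rewrite /rep gns_rep_vec mulr1.
pose tau a := inner (rep (alpha g a) (T xi)) (T xi : gns pp).
have tp : positive tau by exact: (rep_vec_positive rr').
have tauE a : complex.Re (tau (star a * a)) = rnorm (T (gns_vec pp a) : gns pp) ^+ 2.
  have -> : tau (star a * a) = inner (T (rep a xi) : gns pp) (T (rep a xi) : gns pp).
    by rewrite Tcomm; exact: (rep_starM rr').
  by rewrite piv innerE.
have phiE a : complex.Re (phi (star a * a)) = rnorm (gns_vec pp a) ^+ 2.
  by rewrite -(inner_gns pp) innerE.
have tE : forall a, tau a = tau 1 * phi a.
  apply: (pure_dominated pure tp) => a; rewrite tauE phiE.
  by rewrite ler_pXn2r ?nnegrE ?rnorm_ge0//; exact: T1.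
pose t := rnorm (T xi : gns pp) ^+ 2.
have t1E : tau 1 = t%:C.
  rewrite /tau (star_morphism1 (alpha_morphism act g)).
  have -> : rep 1 (T xi) = T xi by exact: gns_rep1.
  by rewrite innerE.
have Tn a : rnorm (T (gns_vec pp a) : gns pp) ^+ 2 = t * rnorm (gns_vec pp a) ^+ 2.
  by rewrite -tauE tE t1E Re_realM phiE.
(* If T xi = 0, then testing against the vector of a0^* gives psi(a0 g) = 0, contrary to the choice
   of a0. *)
have t0 : 0 < t.
  rewrite lt_neqAle sqr_ge0 andbT eq_sym; apply/eqP => t0; apply: a0n.
  have := Tn 1; rewrite t0 mul0r => /eqP; rewrite expf_eq0 /= => /eqP/rnorm_eq0 h.
  have := TE (1 : A) (star a0);
    rewrite -/(gns_vec pp 1) h /s (star_morphism_star im) starK.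
  by rewrite (star_morphism1 im) mulr1.
(* T^* T acts as t on the dense set of GNS vectors, so T / sqrt t is isometric there. *)
pose W (F : gns pp) : gns pp := (Num.sqrt t)^-1%:C *: (T F : gns pp).
have st0 : 0 < Num.sqrt t by rewrite sqrtr_gt0.
have Wl : linear W.
  by move=> c x y; rewrite /W Tl scalerDr !scalerA mulrC.
have Wc a F : W (rep a F) = rep (alpha g a) (W F).
  by rewrite /W Tcomm (linearZ_of (rep_op_linear rr _)).
have Wv a : rnorm (W (gns_vec pp a)) = rnorm (gns_vec pp a).
  apply/eqP; rewrite -(@eqrXn2 _ 2) ?rnorm_ge0// rnormZ modulus_real exprMn Tn.
  rewrite ger0_norm ?invr_ge0 ?sqrtr_ge0// exprVn sqr_sqrtr ?(ltW t0)//.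
  by rewrite mulKf ?eqxx// gt_eqF.
have Wb F : rnorm (W F) <= (Num.sqrt t)^-1 * rnorm F.
  rewrite rnormZ modulus_real ger0_norm ?invr_ge0 ?sqrtr_ge0//.
  rewrite ler_wpM2l ?invr_ge0 ?sqrtr_ge0//; exact: T1.
have Wn F : rnorm (W F) = rnorm F.
  apply/subr0_eq/eqP; rewrite -normr_eq0 eq_le normr_ge0 andbT.
  apply: (@le0_inv_nat _ ((Num.sqrt t)^-1 + 1)) => n.
  have n0 : 0 < n.+1%:R^-1 :> R by rewrite invr_gt0.
  have [a Fa] := gns_dense F n0.
  have h1 := rnorm_sub_le F (gns_vec pp a).
  have h2 := rnorm_sub_le (gns_vec pp a) F; rewrite rnormBC in h2.
  have h3 := rnorm_sub_le (W F) (W (gns_vec pp a)).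
  have h4 := rnorm_sub_le (W (gns_vec pp a)) (W F); rewrite rnormBC in h4.
  rewrite -(linearB_of Wl) Wv in h3; rewrite -(linearB_of Wl) Wv in h4.
  have h5 := Wb (F - gns_vec pp a).
  have h6 : (Num.sqrt t)^-1 * rnorm (F - gns_vec pp a) <= (Num.sqrt t)^-1 * n.+1%:R^-1.
    by rewrite ler_wpM2l ?invr_ge0 ?sqrtr_ge0// ltW.
  rewrite mulrDl mul1r ler_norml; apply/andP.
  move: h1 h2 h3 h4 h5 h6 Fa.
  move: ((Num.sqrt t)^-1 * n.+1%:R^-1) (n.+1%:R^-1 : R) ((Num.sqrt t)^-1 * _) => x y z.
  by move=> *; split; lra.
have Wi := isometry_inner Wl Wn.
(* The range of an isometry is closed, and the intertwining relation makes it invariant under the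
   twisted representation, which is irreducible. *)
have Ws y : exists x, W x = y.
  have [||E|E] := irr'.2 (range W).
  - split.
    + by exists 0 => //; exact: linear0_of Wl.
    + by move=> c _ _ [x _ <-] [z _ <-]; exists (c *: x + z); rewrite ?Wl.
    + exact: isometry_range_closed.
  - by move=> a _ [x _ <-]; exists (rep a x) => //; exact: Wc.
  - have : range W (W xi) by exists xi.
    rewrite E /= => /(congr1 (@rnorm _ _)); rewrite Wn rnorm0 gns_vec1_norm;
      last exact: state1 pure.1.
    by move=> /eqP; rewrite oner_eq0.
  - have : range W y by rewrite E.
    by move=> [x _ xy]; exists x.
apply: (free g g1); exists (irrep_class irp); split; first by exists irp.
rewrite spectrum_act_class; apply/irrep_class_eq/unitarily_equivalent_sym.
by exists W.
Qed.

End Full.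

Context (Bf : cstarType R) (iotaf : A -> Bf) (uf : G -> Bf).
Hypothesis cf : full_crossed_product alpha iotaf uf.
Context (Br : cstarType R) (iotar : A -> Br) (ur : G -> Br).
Hypothesis cr : reduced_crossed_product alpha iotar ur.

(** Two extensions on the reduced side lift to extensions of the same phi on the full side; the
    lifts agree, hence so do the coefficients of the original states. *)
Lemma pep_full_reduced : pure_extension_property iotaf -> pure_extension_property iotar.
Proof.
move=> pep phi pure.
have [psi sp pE] := state_extension_reduced cr pure.1.
exists psi; split=> // psi' [sp' pE'].
have [q sq qE] := lift_state cr cf sp.
have [q' sq' qE'] := lift_state cr cf sp'.
have [q0 [_ uq]] := pep phi pure.
have res (p : Br -> R[i]) (p' : Bf -> R[i]) : p \o iotar = phi ->
    (forall g a, p' (iotaf a * uf g) = p (iotar a * ur g)) -> p' \o iotaf = phi.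
  move=> pe pe'; apply/funext => a /=.
  by rewrite -(crossed_iota1 cf) pe' (crossed_iota1 cr) -pe.
have qq : q = q'.
  by transitivity q0; [apply/esym|]; apply: uq; split=> //;
    [exact: res pE qE|exact: res pE' qE'].
by apply: (crossed_state_ext cr sp sp') => g a; rewrite -qE -qE' qq.
Qed.

(** An extension is obtained by lifting the one on the reduced product; any two agree because both
    have coefficients phi at e and 0 elsewhere. *)
Lemma pep_full_of_free : free_on_spectrum act -> pure_extension_property iotaf.
Proof.
move=> free phi pure.
have [psi sp pE] := state_extension_reduced cr pure.1.
have [q sq qE] := lift_state cr cf sp.
have qi : q \o iotaf = phi.
  apply/funext => a /=.
  by rewrite -(crossed_iota1 cf) qE (crossed_iota1 cr) -pE.
exists q; split=> // q' [sq' qi'].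
apply: (crossed_state_ext cf sq sq') => g a.
have [->|/eqP g1] := eqVneq g 1%g.
  by rewrite !(crossed_iota1 cf) -[q _]/((q \o iotaf) a) qi -qi'.
by rewrite (free_coefficient cf free pure sq qi g1) (free_coefficient cf free pure sq' qi' g1).
Qed.

End Main.

Theorem theorem2p4 (R : realType) (G : groupType) (A : cstarType R)
    (alpha : G -> A -> A) (act : action_by_automorphisms alpha)
    (Bf : cstarType R) (iotaf : A -> Bf) (uf : G -> Bf)
    (Bf_full : full_crossed_product alpha iotaf uf)
    (Br : cstarType R) (iotar : A -> Br) (ur : G -> Br)
    (Br_reduced : reduced_crossed_product alpha iotar ur) :
  (pure_extension_property iotaf <-> pure_extension_property iotar) /\
  (pure_extension_property iotar <-> free_on_spectrum act).
Proof.
have i_ii := pep_full_reduced act Bf_full Br_reduced.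
have ii_iii := @free_of_pep R G A alpha act Br iotar ur Br_reduced.
have iii_i := pep_full_of_free Bf_full Br_reduced (act := act).
split; split; [exact: i_ii|by move=> /ii_iii/iii_i|exact: ii_iii|by move=> /iii_i/i_ii].
Qed.
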